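(* Let $G$ be a Cameron-Walker graph with edge ideal $I(G)$. Then for every integer $s$ with $1\leq s\leq \operatorname{ht}(I(G))$, we have $$\operatorname{reg}(I(G)^{\{s\}})=s+\operatorname{ind-match}(G).$$
   Context: Let $\mathbb{K}$ be a field and let $G$ be a finite simple graph with vertex set $\{x_1,\ldots,x_n\}$; vertices are identified with the variables of $S=\mathbb{K}[x_1,\ldots,x_n]$. The edge ideal is $I(G)=(x_ix_j : x_ix_j\in E(G))\subseteq S$; its height $\operatorname{ht}(I(G))$ equals the smallest cardinality of a vertex cover of $G$. For a squarefree monomial ideal $I$ with irredundant primary decomposition $I=\mathfrak{p}_1\cap\cdots\cap\mathfrak{p}_r$ (each $\mathfrak{p}_i$ generated by variables), the $s$-th symbolic power ($s\ge 1$) is $I^{(s)}=\mathfrak{p}_1^s\cap\cdots\cap\mathfrak{p}_r^s$. The squarefree part of a monomial ideal is the ideal generated by all squarefree monomials in it; $I^{\{s\}}$ denotes the squarefree part of $I^{(s)}$. For a graded $S$-module $M$ with graded Betti numbers $\beta_{i,j}(M)$, $\operatorname{reg}(M)=\max\{j-i : \beta_{i,j}(M)\neq 0\}$ (here $I(G)^{\{s\}}$ is regarded as a graded $S$-module). A matching is a set of pairwise disjoint edges, and $\operatorname{match}(G)$ is the maximum cardinality of a matching of $G$. A matching $M$ is an induced matching if for every pair of edges $e,e'\in M$ there is no edge $f\in E(G)\setminus M$ with $f\subset e\cup e'$; $\operatorname{ind-match}(G)$ is the maximum cardinality of an induced matching. A graph $G$ (not necessarily connected) is a Cameron-Walker graph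 if $\operatorname{match}(G)=\operatorname{ind-match}(G)$. *)

(* Defs.v *)
(* S = K[x_1, ..., x_n] is {mpoly K[n]}; the vertex
   x_i of a graph is the index i : 'I_n. *)
From HB Require Import structures.
From mathcomp Require Import all_boot all_order all_algebra.
From mathcomp Require Export mpoly.

Set Implicit Arguments.
Unset Strict Implicit.
Unset Printing Implicit Defensive.

Import GRing.Theory.
Local Open Scope ring_scope.

Section Graphs.
Variables (n : nat) (e : rel 'I_n).

Definition edges : {set {set 'I_n}} :=
  [set A | [exists i, exists j, e i j && (A == [set i; j])]].

Definition matching (M : {set {set 'I_n}}) : bool :=
  (M \subset edges) && trivIset M.

Definition induced_matching (M : {set {set 'I_n}}) : bool :=
  matching M &&
  [forall a in M, forall b in M, forall f in edges :\: M,
     ~~ (f \subset a :|: b)].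

Definition match_num : nat := (\max_(M | matching M) #|M|)%N.

Definition ind_match : nat := (\max_(M | induced_matching M) #|M|)%N.

Definition cameron_walker : Prop := match_num = ind_match.

End Graphs.

Section Ideals.
Variables (n : nat) (K : fieldType).
Local Notation S := {mpoly K[n]}.

(* Ideals are given by their membership predicate S -> Prop. *)
Definition ideal_gen (A : S -> Prop) (f : S) : Prop :=
  exists (m : nat) (c g : 'I_m -> S),
    (forall i, A (g i)) /\ f = \sum_i c i * g i.

Definition ideal_pow (I : S -> Prop) (s : nat) : S -> Prop :=
  ideal_gen (fun f => exists g : 'I_s -> S,
    (forall i, I (g i)) /\ f = \prod_i g i).

Definition edge_ideal (e : rel 'I_n) : S -> Prop :=
  ideal_gen (fun f => exists i j, e i j /\ f = 'X_i * 'X_j).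

Definition var_ideal (C : {set 'I_n}) : S -> Prop :=
  ideal_gen (fun f => exists2 i, i \in C & f = 'X_i).

(* I is the irredundant intersection of the primes (x_i : i \in C), C \in D. *)
Definition irredundant_decomposition (I : S -> Prop)
    (D : {set {set 'I_n}}) : Prop :=
  (forall f, I f <-> (forall C, C \in D -> var_ideal C f)) /\
  (forall C, C \in D ->
     exists f, (forall C', C' \in D :\ C -> var_ideal C' f) /\ ~ I f).

(* The decomposition of a squarefree monomial ideal exists and is unique, so
   the existential quantifier only names it. *)
Definition symbolic_power (I : S -> Prop) (s : nat) (f : S) : Prop :=
  exists2 D, irredundant_decomposition I D &
    forall C, C \in D -> ideal_pow (var_ideal C) s f.

Definition sqfree_mnm (m : 'X_{1..n}) : Prop := forall i, (m i <= 1)%N.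

Definition sqfree_part (I : S -> Prop) : S -> Prop :=
  ideal_gen (fun f => exists m, [/\ sqfree_mnm m, f = 'X_[m] & I f]).

Definition sqfree_symbolic_power (I : S -> Prop) (s : nat) : S -> Prop :=
  sqfree_part (symbolic_power I s).

Definition prime_ideal (P : {pred S}) : Prop :=
  idealr_closed P /\ prime_idealr_closed P.

(* h <= ht(P): a chain of primes Q 0 < Q 1 < ... < Q h = P. *)
Definition le_prime_height (h : nat) (P : {pred S}) : Prop :=
  exists Q : nat -> {pred S},
    [/\ forall i, (i <= h)%N -> prime_ideal (Q i),
        forall i, (i < h)%N -> {subset Q i <= Q i.+1} /\
                               exists2 f, f \in Q i.+1 & f \notin Q i
      & Q h =i P].

(* h <= ht(I), where ht(I) is the infimum of ht(P) over the primes P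
   containing I. *)
Definition le_height (h : nat) (I : S -> Prop) : Prop :=
  forall P : {pred S}, prime_ideal P -> (forall f, I f -> f \in P) ->
    le_prime_height h P.

(* Data of a sequence ... -> F_1 -> F_0 -> S of graded free modules, where
   F_i = \bigoplus_(k < gf_rank i) S(- gf_shift i k).  Elements of F_i are row
   vectors and maps act by right multiplication.  An ideal has its minimal
   generators, hence all its minimal shifts, in nonnegative degree. *)
Record graded_free_seq := GradedFreeSeq {
  gf_rank : nat -> nat;
  gf_shift : forall i, 'I_(gf_rank i) -> nat;
  gf_diff : forall i, 'M[S]_(gf_rank i.+1, gf_rank i);
  gf_aug : 'cV[S]_(gf_rank 0)
}.

(* The map \bigoplus_k S(- a k) -> \bigoplus_l S(- b l) has degree 0. *)
Definition graded_mx (p q : nat) (a : 'I_p -> nat) (b : 'I_q -> nat)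
    (A : 'M[S]_(p, q)) : Prop :=
  forall k l, if (b l <= a k)%N then A k l \is (a k - b l)%N.-homog
              else A k l == 0.

Record minimal_graded_free_resolution (F : graded_free_seq) (I : S -> Prop) :
    Prop := {
  aug_graded : graded_mx (@gf_shift F 0) (fun=> 0%N) (gf_aug F);
  diff_graded : forall i,
    graded_mx (@gf_shift F i.+1) (@gf_shift F i) (gf_diff F i);
  aug_image : forall f, I f <->
    exists u : 'rV_(gf_rank F 0), f = (u *m gf_aug F) 0 0;
  aug_exact : forall u : 'rV_(gf_rank F 0),
    u *m gf_aug F = 0 <-> exists v : 'rV_(gf_rank F 1), u = v *m gf_diff F 0;
  diff_exact : forall i (u : 'rV_(gf_rank F i.+1)),
    u *m gf_diff F i = 0 <-> exists v : 'rV_(gf_rank F i.+2), u = v *m gf_diff F i.+1;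
  (* the image of F_(i+1) lies in (x_1, ..., x_n) F_i *)
  diff_minimal : forall i k l, (gf_diff F i k l)@_0%MM = 0
}.

(* b = beta_(i,j)(I), which does not depend on the resolution. *)
Definition graded_betti (I : S -> Prop) (i j b : nat) : Prop :=
  exists2 F, minimal_graded_free_resolution F I &
    b = #|[set k | @gf_shift F i k == j]|.

(* r = reg(I) = max {j - i : beta_(i,j)(I) <> 0}. *)
Definition regularity (I : S -> Prop) (r : int) : Prop :=
  (exists i j b : nat, [/\ graded_betti I i j b, b <> 0%N & r = j%:Z - i%:Z])
  /\ (forall i j b : nat, graded_betti I i j b -> b <> 0%N ->
        j%:Z - i%:Z <= r).

End Ideals.

Arguments edge_ideal {n} K e _.

(* Main.v *)
(* The squarefree part of I(G)^(s) is spanned by the monomials whose support A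
   satisfies s <= tau(A), where tau(A) is the vertex cover number of the induced
   subgraph G[A].  Betti numbers are read off Koszul homology, which in the
   multidegree of a set W is the reduced homology of the complex of all B with
   s <= tau(W \ B); deleting and contracting a vertex of W gives a long exact
   sequence.

   Let M be an induced matching that is maximum among all matchings.  As M has no
   augmenting path, every edge of M has an end y whose other neighbours are
   neighbours of the other end x, so that tau(A) = 1 + tau(A \ x) whenever A
   contains x and y.  Hence, once the vertices of M have been deleted or
   contracted, tau is a matroid rank function on the remaining independent
   vertices, and the contracted part Z has |Z| <= |M| + tau(Z).  Induction
   over deletions and contractions gives reg <= s + |M|.  For s <= |M| the bound
   is attained in the multidegree of the vertices of M; for s > |M| adding
   s - |M| uncovered vertices, independent for the rank function, gives a minimal
   generator of degree s + |M|. *)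
Require Import Defs.
From mathcomp Require Import all_boot all_order all_algebra.
From mathcomp Require Import zify ring.
From Stdlib Require Import IndefiniteDescription Classical.

Set Implicit Arguments.
Unset Strict Implicit.
Unset Printing Implicit Defensive.

Import GRing.Theory.
Local Open Scope ring_scope.

(** * Koszul differential and simplicial acyclicity *)

(** Regularity is stated through minimal resolutions, so algebra surrounds the combinatorics on both
    sides. Koszul homology is shifted along a given minimal resolution: for 0 -> Y -> F -> N -> 0
    with F free on minimal generators of N, H_(i+1)(N) = H_i(Y), until H_0 counts generators.
    Attaining the bound also requires a resolution to exist; it is built from minimal generators of
    successive kernels, finite in number because a degree bound on Koszul homology passes to the
    kernel by the same shift.

    The combinatorial induction runs over pairs (W, Z), where the vertices of Z always count in
    [tau]. The deletion of v moves v from W to Z and keeps |W| + |Z|; the link drops v and lowers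
    the homological degree i by one. Both preserve s + |M| + i < |W| + |Z|, which for Z empty says
    that j = |W| exceeds i + s + |M|.

    The height, given by chains of primes, is compared with the cover number of G by counting
    algebraically independent elements modulo the primes of a chain. *)

Section KoszulDifferential.
Variables (n : nat) (R : comNzRingType) (V : lmodType R) (x : 'I_n -> R).
Implicit Types (z : {set 'I_n} -> V) (B : {set 'I_n}) (v w : 'I_n).

(** The sign relating e_v /\ e_B to the basis element of [v |: B]. *)
Definition ksgn v B : R := (-1) ^+ #|[set u in B | (u < v)%N]|.

(* z B is the coefficient of the exterior basis element e_B of a chain z. *)
Definition kdiff z B : V := \sum_(v | v \notin B) (ksgn v B * x v) *: z (v |: B).

Lemma ksgn_sqr v B : ksgn v B * ksgn v B = 1.
Proof. by rewrite -expr2 sqrr_sign. Qed.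

Lemma ksgnU v w B : w \notin B ->
  ksgn v (w |: B) = if (w < v)%N then - ksgn v B else ksgn v B.
Proof.
move=> wB; rewrite /ksgn; case: ifP => wv.
  have -> : [set u in w |: B | (u < v)%N] = w |: [set u in B | (u < v)%N].
    by apply/setP=> u; rewrite !inE andb_orl; case: eqP => // ->; rewrite wv.
  by rewrite cardsU1 !inE (negPf wB) /= exprS mulN1r.
congr (_ ^+ _); apply: eq_card => u; rewrite !inE andb_orl.
by case: eqP => // ->; rewrite wv andbF.
Qed.

Lemma ksgn_anti v w B : v \notin B -> w \notin B -> v != w ->
  ksgn v B * ksgn w (v |: B) + ksgn w B * ksgn v (w |: B) = 0.
Proof.
move=> vB wB; rewrite neq_ltn !ksgnU //.
by case/orP=> h; rewrite h ltnNge (ltnW h) /=; ring.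
Qed.

Lemma eq_kdiff z z' B : (forall C, z C = z' C) -> kdiff z B = kdiff z' B.
Proof. by move=> zz'; apply: eq_bigr => v _; rewrite zz'. Qed.

Lemma kdiffD z z' B : kdiff (fun C => z C + z' C) B = kdiff z B + kdiff z' B.
Proof. by rewrite -big_split; apply: eq_bigr => v _; rewrite scalerDr. Qed.

Lemma kdiffN z B : kdiff (fun C => - z C) B = - kdiff z B.
Proof. by rewrite -sumrN; apply: eq_bigr => v _; rewrite scalerN. Qed.

Lemma kdiffB z z' B : kdiff (fun C => z C - z' C) B = kdiff z B - kdiff z' B.
Proof. by rewrite kdiffD kdiffN. Qed.

Lemma kdiff0 B : kdiff (fun=> 0) B = 0.
Proof. by rewrite /kdiff big1 // => v _; rewrite scaler0. Qed.

Lemma kdiffK z B : kdiff (kdiff z) B = 0.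
Proof.
pose F v w := (ksgn v B * x v) *: ((ksgn w (v |: B) * x w) *: z (w |: (v |: B))).
have -> : kdiff (kdiff z) B =
    \sum_(v | v \notin B) \sum_(w | (w \notin B) && (v != w)) F v w.
  apply: eq_bigr => v vB; rewrite scaler_sumr; apply: eq_bigl => w.
  by rewrite !inE negb_or eq_sym andbC.
(* Each pair added to B occurs in both orders; exchanging the sums on one half matches the two
   orders, whose signs cancel. *)
have -> : \sum_(v | v \notin B) \sum_(w | (w \notin B) && (v != w)) F v w =
   \sum_(v | v \notin B) \sum_(w | (w \notin B) && (v < w)%N) F v w +
   \sum_(v | v \notin B) \sum_(w | (w \notin B) && (w < v)%N) F v w.
  rewrite -big_split; apply: eq_bigr => v vB /=.
  rewrite (bigID (fun w => (v < w)%N)) /=; congr (_ + _); apply: eq_bigl => w;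
    rewrite neq_ltn; case: (ltngtP v w) => //=; rewrite ?andbT ?andbF //.
rewrite [X in _ + X](exchange_big_dep (fun v => v \notin B)) /=; last first.
  by move=> v w _ /andP[].
rewrite -big_split big1 //= => v vB.
rewrite [X in _ + X](eq_bigl (fun w => (w \notin B) && (v < w)%N)); last first.
  by move=> w /=; rewrite vB.
rewrite -big_split big1 //= => w /andP[wB vw].
have nvw : v != w by rewrite neq_ltn vw.
rewrite /F !scalerA (setUCA [set v]) -scalerDl.
have -> : ksgn v B * x v * (ksgn w (v |: B) * x w) +
   ksgn w B * x w * (ksgn v (w |: B) * x v) =
  (ksgn v B * ksgn w (v |: B) + ksgn w B * ksgn v (w |: B)) * (x v * x w) by ring.
by rewrite ksgn_anti // mul0r scale0r.
Qed.

Lemma kdiff_supp z i : (forall B, z B != 0 -> #|B| = i.+1) ->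
  forall B, kdiff z B != 0 -> #|B| = i.
Proof.
move=> zi B; apply: contraTeq => nBi; rewrite negbK; apply/eqP; apply: big1 => v vB.
case: (eqVneq (z (v |: B)) 0) => [-> | /zi]; first by rewrite scaler0.
by rewrite cardsU1 vB add1n => -[] Bi; rewrite Bi eqxx in nBi.
Qed.

End KoszulDifferential.

Section SimplicialAcyclicity.
Variables (n : nat) (K : fieldType).
Implicit Types (D E L : {set 'I_n} -> bool) (c : {set 'I_n} -> K^o) (B : {set 'I_n}).

Notation bdr := (@kdiff n K K^o (fun=> 1)).

Definition chain_on D i c := forall B, c B != 0 -> D B /\ #|B| = i.

(** Faces are graded by cardinality, so index [i] is reduced homology in dimension i - 1, and
    [i = 0] concerns the empty face. *)
Definition acyclic D i := forall c, chain_on D i c -> (forall B, bdr c B = 0) ->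
  exists2 b, chain_on D i.+1 b & forall B, bdr b B = c B.

Lemma eq_acyclic D E i : D =1 E -> acyclic D i -> acyclic E i.
Proof.
move=> DE aD c cE c0; have [|b bD bc] := aD c _ c0.
  by move=> B /cE; rewrite DE.
by exists b => // B /bD; rewrite DE.
Qed.

Definition cone_op (v : 'I_n) c B : K^o :=
  if v \in B then ksgn K v (B :\ v) * c (B :\ v) else 0.

Definition link_op (v : 'I_n) c B : K^o :=
  if v \in B then 0 else ksgn K v B * c (v |: B).

(** The homotopy identity d h + h d = 1 for coning from v, on chains of the full simplex. *)
Lemma bdr_cone v c B : bdr (cone_op v c) B = c B - cone_op v (bdr c) B.
Proof.
rewrite {2}/cone_op; case: ifPn => vB; last first.
  rewrite subr0 /kdiff (bigD1 v) //= big1 ?addr0 => [|u /andP[uB uv]].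
    by rewrite /cone_op setU11 setU1K // mulr1 scalerA ksgn_sqr scale1r.
  by rewrite /cone_op !inE eq_sym (negPf uv) (negPf vB) scaler0.
have vB' : v \notin B :\ v by rewrite !inE eqxx.
rewrite /kdiff [in RHS](bigD1 v) //= setD1K // mulrDr opprD addrA.
rewrite mulr1 -[ksgn K v _ *: c B]/(ksgn K v _ * c B) mulrA ksgn_sqr mul1r subrr sub0r.
rewrite mulr_sumr -sumrN; apply: eq_big => [u|u uB].
  by rewrite !inE negb_and negbK; case: eqP => [->|]; rewrite ?vB ?andbT ?andbF.
have uv : u != v by apply: contraNneq uB => ->.
have uB' : u \notin B :\ v by rewrite !inE (negPf uB) andbF.
rewrite /cone_op inE vB orbT !mulr1.
have -> : (u |: B) :\ v = u |: (B :\ v).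
  by apply/setP=> w; rewrite !inE; case: eqP => // ->; rewrite eq_sym (negPf uv).
have := ksgn_anti K vB' uB'; rewrite eq_sym => /(_ uv) /eqP; rewrite addr_eq0 setD1K // => /eqP h.
rewrite -[_ *: (_ * _)]/(_ * (_ * _)) -[_ *: c _]/(_ * c _) !mulrA -mulNr; congr (_ * _).
have := ksgn_sqr K v (B :\ v) => e1.
have -> : ksgn K u B = ksgn K v (B :\ v) * ksgn K v (B :\ v) * ksgn K u B by rewrite e1 mul1r.
rewrite -[in LHS](mulrA (ksgn K v (B :\ v))) h.
by rewrite mulrN mulNr -!mulrA ksgn_sqr mulr1.
Qed.

(** The boundary is the sum of all the contractions [link_op u], and contractions anticommute. *)
Lemma bdr_link v c B : bdr (link_op v c) B = - link_op v (bdr c) B.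
Proof.
rewrite {2}/link_op; case: ifPn => vB.
  rewrite oppr0 /kdiff big1 // => u uB.
  by rewrite /link_op inE vB orbT scaler0.
rewrite /kdiff (bigD1 v) //= [link_op v c _]/link_op setU11 scaler0 add0r.
rewrite mulr_sumr -sumrN; apply: eq_big => [u|u /andP[uB uv]].
  by rewrite !inE negb_or andbC.
have vu : v != u by rewrite eq_sym.
rewrite /link_op !inE (negPf vu) (negPf vB) !mulr1.
rewrite -[_ *: (_ * _)]/(_ * (_ * _)) -[_ *: c _]/(_ * c _) !mulrA setUCA -mulNr; congr (_ * _).
by apply/eqP; rewrite -addr_eq0 addrC; apply/eqP/ksgn_anti.
Qed.

Lemma acyclic_cone D v i : (forall B, v \notin B -> D B = D (v |: B)) -> acyclic D i.
Proof.
move=> Dv c cD c0; exists (cone_op v c).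
  move=> B; rewrite /cone_op; case: ifP => [vB|]; last by rewrite eqxx.
  rewrite mulf_eq0 negb_or => /andP[_ /cD[DB Bi]].
  have vB' : v \notin B :\ v by rewrite !inE eqxx.
  by rewrite -(setD1K vB) cardsU1 vB' Bi -Dv.
move=> B; rewrite bdr_cone /cone_op; case: ifP => _; rewrite ?c0 ?mulr0 subr0 //.
Qed.

(** * The long exact sequence of deletion and link *)

Section DeletionLink.
Variables (D E L : {set 'I_n} -> bool) (v : 'I_n).
Hypothesis EE : forall B, E B = (v \notin B) && D B.
Hypothesis LE : forall B, L B = (v \notin B) && D (v |: B).
Hypothesis Ddown : forall B, v \notin B -> D (v |: B) -> D B.

Let LsubE B : L B -> E B.
Proof. by rewrite LE EE => /andP[vB /(Ddown vB) ->]; rewrite vB. Qed.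

Let EsubD i c : chain_on E i c -> chain_on D i c.
Proof. by move=> cE B /cE[]; rewrite EE => /andP[]. Qed.

Let link_chain i c : chain_on D i.+1 c -> chain_on L i (link_op v c).
Proof.
move=> cD B; rewrite /link_op LE; case: ifP => [|/negbT vB]; first by rewrite eqxx.
by rewrite mulf_eq0 negb_or => /andP[_ /cD[-> ]]; rewrite cardsU1 vB => -[].
Qed.

Let coneL i d : chain_on L i d -> chain_on D i.+1 (cone_op v d).
Proof.
move=> dL B; rewrite /cone_op; case: ifP => [vB|]; last by rewrite eqxx.
rewrite mulf_eq0 negb_or => /andP[_ /dL[]]; rewrite LE setD1K // => /andP[vB' DB] Bi.
by rewrite -(setD1K vB) cardsU1 vB' Bi setD1K.
Qed.

Let bdr_coneL i d : chain_on L i d -> forall B, v \notin B -> bdr (cone_op v d) B = d B.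
Proof. by move=> dL B vB; rewrite bdr_cone /cone_op (negPf vB) subr0. Qed.

Let link_coneL i d : chain_on L i d -> forall B, link_op v (cone_op v d) B = d B.
Proof.
move=> dL B; rewrite /link_op; case: ifP => vB.
  by apply/esym; apply: contraTeq vB => /dL[]; rewrite LE => /andP[].
rewrite /cone_op setU11 setU1K ?vB // -[RHS]mul1r -(ksgn_sqr K v B) -mulrA //.
Qed.

(* If the link part of c is the boundary of d in L, adding the boundary of the cone
   over d pushes c off the star of v. *)
Let push_off i c d : chain_on D i c -> chain_on L i d ->
  (forall B, bdr d B = link_op v c B) ->
  chain_on E i (fun B => c B + bdr (cone_op v d) B).
Proof.
move=> cD dL dc B.
case: (boolP (v \in B)) => [vB|vB].
  rewrite bdr_cone {1}/cone_op vB dc /link_op !inE eqxx /= setD1K // mulrA ksgn_sqr mul1r.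
  have -> : d B = 0.
    by apply: contraTeq vB => /dL[]; rewrite LE => /andP[].
  by rewrite sub0r subrr eqxx.
rewrite (bdr_coneL dL) //.
case: (eqVneq (c B) 0) => [->|/cD[DB Bi] _].
  by rewrite add0r => /dL[/LsubE EB]; split.
by rewrite EE vB.
Qed.

Let coneD_supp i d c : chain_on D i.+1 c -> chain_on D i.+1 d ->
  chain_on D i.+1 (fun B => c B - d B).
Proof.
move=> cD dD B; case: (eqVneq (c B) 0) => [->|/cD //].
by rewrite sub0r oppr_eq0 => /dD.
Qed.

(** Exactness of H_i(E) -> H_i(D) -> H_(i-1)(L): the link part of a cycle bounds in L, which allows
    the cycle to be pushed into the deletion, where it bounds. *)
Lemma acyclic_del_link i : acyclic E i -> (forall j, i = j.+1 -> acyclic L j) ->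
  acyclic D i.
Proof.
move=> aE aL c cD c0.
have [d dL dc] : exists2 d, chain_on L i d & forall B, bdr d B = link_op v c B.
  case: i aE aL cD => [|i] aE aL cD.
    exists (fun=> 0) => [B|B]; first by rewrite eqxx.
    rewrite kdiff0 /link_op; case: ifP => // /negbT vB.
    case: (eqVneq (c (v |: B)) 0) => [->|/cD[_]]; first by rewrite mulr0.
    by rewrite cardsU1 vB.
  apply: (aL i (erefl _)); first exact: link_chain.
  by move=> B; rewrite bdr_link /link_op c0 mulr0; case: ifP; rewrite oppr0.
have cE := push_off cD dL dc.
have [|e eE ec] := aE _ cE.
  by move=> B; rewrite kdiffD c0 kdiffK addr0.
exists (fun B => e B - cone_op v d B).
  by apply: coneD_supp; [apply: EsubD | apply: coneL].
by move=> B; rewrite kdiffB ec addrK.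
Qed.

(** Exactness of H_i(L) -> H_i(E) -> H_i(D): if a cycle of E bounds c in D, the link part of c is a
    cycle because the boundary of c avoids v; filling it moves c into E. *)
Lemma not_acyclic_del i : acyclic L i -> ~ acyclic E i -> ~ acyclic D i.
Proof.
move=> aL naE aD; apply: naE => e eE e0.
have [c cD ce] := aD e (EsubD eE) e0.
have [|B|d dL dc] := aL (link_op v c); first exact: link_chain.
  rewrite bdr_link /link_op ce; case: ifP => vB; first by rewrite oppr0.
  case: (eqVneq (e (v |: B)) 0) => [->|/eE[]]; first by rewrite mulr0 oppr0.
  by rewrite EE setU11.
exists (fun B => c B + bdr (cone_op v d) B); first exact: push_off.
by move=> B; rewrite kdiffD ce kdiffK addr0.
Qed.

(** Exactness of H_(i+1)(D) -> H_i(L) -> H_i(E): if a cycle l of L bounds e in E, then e minus the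
    cone over l is a cycle of D, and the link part of any filling of it fills l. *)
Lemma not_acyclic_link i : acyclic E i -> ~ acyclic L i -> ~ acyclic D i.+1.
Proof.
move=> aE naL aD; apply: naL => l lL l0.
have lE : chain_on E i l by move=> B /lL[/LsubE].
have [e eE el] := aE l lE l0.
have cD : chain_on D i.+1 (fun B => e B - cone_op v l B).
  by apply: coneD_supp; [apply: EsubD | apply: coneL].
have [|d dD dc] := aD _ cD.
  move=> B; rewrite kdiffB el bdr_cone /cone_op.
  by case: ifP; rewrite ?l0 ?mulr0 subr0 subrr.
exists (link_op v d); first exact: link_chain.
move=> B; rewrite bdr_link -(link_coneL lL) /link_op; case: ifP => vB; first by rewrite oppr0.
rewrite dc.
have -> : e (v |: B) = 0.
  by apply/eqP; apply/negPn/negP => /eE[]; rewrite EE setU11.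
by rewrite sub0r mulrN opprK.
Qed.

End DeletionLink.

End SimplicialAcyclicity.

(** * Vertex covers and maximum induced matchings *)

Local Open Scope nat_scope.

Section VertexCovers.
Variables (n : nat) (e : rel 'I_n).
Hypotheses (e_sym : symmetric e) (e_irr : irreflexive e).
Implicit Types (A B C P W Z : {set 'I_n}) (M N : {set {set 'I_n}}).

Definition covers A C :=
  [forall i in A, forall j in A, e i j ==> (i \in C) || (j \in C)].

Lemma coversP A C :
  reflect (forall i j, i \in A -> j \in A -> e i j -> (i \in C) || (j \in C)) (covers A C).
Proof.
apply: (iffP 'forall_in_'forall_in_implyP) => [h i j iA jA eij|h i iA j jA eij]; exact: h.
Qed.

Lemma covers_setT A : covers A setT.
Proof. by apply/coversP => i j _ _ _; rewrite inE. Qed.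

Definition tau A := #|[arg min_(C < setT | covers A C) #|C| ]|.

Lemma tau_le A C : covers A C -> tau A <= #|C|.
Proof. by move=> cC; rewrite /tau; case: arg_minnP => [|D _ ->] //; apply: covers_setT. Qed.

Lemma tau_witness A : {C | covers A C & #|C| = tau A}.
Proof.
rewrite /tau; case: arg_minnP => [|C cC _]; first exact: covers_setT.
by exists C.
Qed.

Lemma tauS A B : A \subset B -> tau A <= tau B.
Proof.
move=> /subsetP AB; have [C /coversP cC <-] := tau_witness B; apply: tau_le.
by apply/coversP => i j /AB iB /AB jB; apply: cC.
Qed.

Lemma tauU A B : tau (A :|: B) <= tau A + #|B|.
Proof.
have [C /coversP cC <-] := tau_witness A.
apply: leq_trans (leq_card_setU C B); apply: tau_le; apply/coversP => i j.
rewrite !inE => /orP[iA|->]; last by rewrite orbT.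
case/orP=> [jA|-> _]; last by rewrite !orbT.
by move/(cC i j iA jA)/orP=> [->|->]; rewrite ?orbT.
Qed.

Lemma tauU1 v A : tau (v |: A) <= (tau A).+1.
Proof. by rewrite setUC -addn1 -(cards1 v) tauU. Qed.

Lemma tau_matching A N : trivIset N ->
  (forall E, E \in N -> exists i j, [/\ e i j, E = [set i; j] & E \subset A]) ->
  #|N| <= tau A.
Proof.
move=> tN eN; have [C /coversP cC <-] := tau_witness A.
apply: leq_trans (leq_imset_card (pblock N) C); apply: subset_leq_card.
apply/subsetP=> E EN; have [i [j [eij E_ij /subsetP EA]]] := eN _ EN.
have iE : i \in E by rewrite E_ij set21.
have jE : j \in E by rewrite E_ij set22.
have /orP[kC|kC] := cC i j (EA i iE) (EA j jE) eij; apply/imsetP.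
  by exists i; rewrite ?(def_pblock tN EN).
by exists j; rewrite ?(def_pblock tN EN).
Qed.

(** A cover of A that misses x contains every neighbour of x in A, hence y and all other neighbours
    of y. So dropping x if present, and y otherwise, leaves a cover of A without x. *)
Lemma tau_dominated x y A : e x y -> (forall w, e y w -> w != x -> e x w) ->
  x \in A -> y \in A -> tau A = (tau (A :\ x)).+1.
Proof.
move=> exy dom xA yA; apply/eqP; rewrite eqn_leq; apply/andP; split.
  by rewrite -{1}(setD1K xA) tauU1.
have [C /coversP cC CA] := tau_witness A; rewrite -CA.
pose z := if x \in C then x else y.
have zC : z \in C.
  by rewrite /z; case: ifP => // xC; have := cC x y xA yA exy; rewrite xC.
rewrite (cardsD1 z C) zC ltnS; apply: tau_le; apply/coversP => i j.
rewrite !inE => /andP[ix iA] /andP[jx jA] eij.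
have := cC i j iA jA eij.
rewrite /z; case: ifPn => xC; first by rewrite ix jx.
case: (eqVneq i y) => [iy _|_ /=].
  subst i; case: (eqVneq j y) eij => [->|_ eyj]; first by rewrite e_irr.
  have := cC x j xA jA (dom _ eyj jx); by rewrite (negPf xC).
case: (eqVneq j y) => [jy _|//].
subst j; have exi : e x i by apply: dom => //; rewrite e_sym.
by have := cC x i xA iA exi; rewrite (negPf xC) /= => ->.
Qed.

Lemma disjoint_setU1 v W Z : [disjoint W & v |: Z] = (v \notin W) && [disjoint W & Z].
Proof. by rewrite disjoint_sym -!setI_eq0 setIUl setU_eq0 !setI_eq0 disjoints1 disjoint_sym. Qed.

Lemma cards_sum C : #|C| = \sum_i (i \in C).
Proof. by rewrite -sum1_card big_mkcond; apply: eq_bigr => i _; case: (i \in C). Qed.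

(* Uncrossing a minimum cover T1 of the small graph with a minimum cover T2 of
   the large one; v lies outside T1, so its neighbours lie inside. *)
Lemma tau_bipartite P (R : {set 'I_n}) B C v : [disjoint P & R] ->
  (forall i j, i \in P -> j \in P -> ~~ e i j) ->
  (forall i j, i \in R -> j \in R -> ~~ e i j) ->
  B \subset C -> C \subset R -> v \in R ->
  tau (v |: (P :|: B)) = tau (P :|: B) -> tau (v |: (P :|: C)) <= tau (P :|: C).
Proof.
move=> PR Pi Ri /subsetP BC /subsetP CR vR tauv.
have [T1 /coversP c1 s1] := tau_witness (v |: (P :|: B)).
have [T2 /coversP c2 s2] := tau_witness (P :|: C).
case: (boolP (v \in P :|: C)) => [vPC|nvPC].
  by rewrite (_ : v |: _ = P :|: C) //; apply/setUidPr; rewrite sub1set.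
have vP : v \notin P by apply: contra nvPC; rewrite inE => ->.
have vC : v \notin C by apply: contra nvPC; rewrite inE orbC => ->.
have vB : v \notin B by apply: contra vC => /BC.
(* Otherwise T1 without v would still cover the smaller set, against [tauv]. *)
have vT1 : v \notin T1.
  apply/negP=> vT1; suff: tau (P :|: B) <= #|T1 :\ v|.
    by rewrite -tauv -s1 (cardsD1 v T1) vT1 ltnn.
  apply: tau_le; apply/coversP => i j iA jA eij.
  have iv : i != v by apply: contraTneq iA => ->; rewrite inE negb_or vP.
  have jv : j != v by apply: contraTneq jA => ->; rewrite inE negb_or vP.
  by rewrite !inE iv jv /=; apply: c1 => //; apply: setU1r.
(* [T] is the union of the two covers on P and their intersection on B, and [T'] the opposite. On C
   outside B, [T] follows T2. Together they use no more vertices than T1 and T2. *)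
pose T := (P :&: (T1 :|: T2)) :|: (C :&: T2 :&: (T1 :|: ~: B)).
pose T' := (P :&: (T1 :&: T2)) :|: (B :&: (T1 :|: T2)).
have cT p q : p \in P -> q \in v |: C -> e p q -> (p \in T) || (q \in T).
  move=> pP qvC epq; rewrite !inE pP /=.
  case: (boolP (p \in T1)) => //= p1; case: (boolP (p \in T2)) => //= p2.
  move: qvC; rewrite !inE => /orP[/eqP qv|qC].
    subst q; have := c1 p v; rewrite !inE pP eqxx orbT => /(_ isT isT epq).
    by rewrite (negPf p1) (negPf vT1).
  have q2 : q \in T2.
    by have := c2 p q; rewrite !inE pP qC (negPf p2) orbT; apply.
  rewrite qC q2 /=; case: (boolP (q \in B)) => qB; rewrite ?orbT //=.
  by have := c1 p q; rewrite !inE pP qB (negPf p1) !orbT => /(_ isT isT epq) /= ->; rewrite !orbT.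
have cT' p q : p \in P -> q \in B -> e p q -> (p \in T') || (q \in T').
  move=> pP qB epq; have := c1 p q; have := c2 p q.
  rewrite !inE pP qB (BC _ qB) !orbT /= => /(_ isT isT epq) h2 /(_ isT isT epq) h1.
  by move: h1 h2; case: (p \in T1); case: (p \in T2); case: (q \in T1); case: (q \in T2);
    rewrite //= !orbT.
have sT : tau (v |: (P :|: C)) <= #|T|.
  apply: tau_le; apply/coversP => i j.
  rewrite setUCA !(in_setU _ P) => /orP[iP|iC] /orP[jP|jC] eij.
  - by have := Pi _ _ iP jP; rewrite eij.
  - exact: cT.
  - by rewrite orbC; apply: cT => //; rewrite e_sym.
  have vCR k : k \in v |: C -> k \in R by case/setU1P=> [->|/CR].
  by have := Ri _ _ (vCR _ iC) (vCR _ jC); rewrite eij.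
have sT' : tau (P :|: B) <= #|T'|.
  apply: tau_le; apply/coversP => i j.
  rewrite !(in_setU _ P) => /orP[iP|iC] /orP[jP|jC] eij.
  - by have := Pi _ _ iP jP; rewrite eij.
  - exact: cT'.
  - by rewrite orbC; apply: cT' => //; rewrite e_sym.
  by have := Ri _ _ (CR _ (BC _ iC)) (CR _ (BC _ jC)); rewrite eij.
have : #|T| + #|T'| <= #|T1| + #|T2|.
  rewrite !cards_sum -!big_split /=; apply: leq_sum => i _; rewrite !inE.
  have hB : (i \in B) ==> (i \in C) by apply/implyP/BC.
  have hP : ~~ ((i \in P) && (i \in C)).
    by apply/negP=> /andP[iP /CR]; rewrite (disjointFr PR iP).
  by move: hB hP; case: (i \in P); case: (i \in B); case: (i \in C);
    case: (i \in T1); case: (i \in T2).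
rewrite s1 s2 tauv; lia.
Qed.

Lemma matching_setU1 M i j : matching e M -> e i j ->
  i \notin cover M -> j \notin cover M ->
  matching e ([set i; j] |: M) /\ #|[set i; j] |: M| = #|M|.+1.
Proof.
move=> /andP[/subsetP Me tM] eij iM jM.
have [||t nE] := @trivIsetU1 _ [set i; j] M _ tM.
- move=> B BM; rewrite disjoint_subset; apply/subsetP=> k; rewrite !inE => kij.
  apply: contraTN kij => kB.
  have kM : k \in cover M by apply/bigcupP; exists B.
  by rewrite negb_or; apply/andP; split; apply: contraTneq kM => ->.
- apply/negP=> /Me; rewrite inE => /existsP[k /existsP[l /andP[_ /eqP kl]]].
  by have := set21 k l; rewrite -kl inE.
split; last by rewrite cardsU1 nE.
rewrite /matching t andbT; apply/subsetP=> E; rewrite inE => /orP[|/Me //].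
rewrite inE => /eqP->; rewrite inE; apply/existsP; exists i; apply/existsP; exists j.
by rewrite eij eqxx.
Qed.

Lemma cameron_walker_matching : cameron_walker e ->
  exists M, [/\ induced_matching e M, #|M| = ind_match e &
                forall N, matching e N -> #|N| <= #|M|].
Proof.
move=> CW; have im0 : induced_matching e set0.
  apply/andP; split; last by apply/forallP => a; rewrite inE.
  by rewrite /matching sub0set; apply/trivIsetP => A B; rewrite inE.
have [|M iM sM] := eq_bigmax_cond (fun M : {set {set 'I_n}} => #|M|) (A := [pred M | induced_matching e M]).
  by apply/card_gt0P; exists set0.
exists M; split=> [||N mN]; rewrite -?sM //.
have -> : \max_(i in [pred M | induced_matching e M]) #|i| = match_num e by rewrite CW.
by rewrite /match_num (bigD1 N) //= leq_maxl.
Qed.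

(** * Cover numbers relative to a maximum matching that is induced *)

Section CameronWalker.
Variable M : {set {set 'I_n}}.
Hypothesis M_ind : induced_matching e M.
Hypothesis M_max : forall N, matching e N -> #|N| <= #|M|.

Local Notation m := #|M|.
Local Notation R := (~: cover M).

Let M_match : matching e M. Proof. by case/andP: M_ind. Qed.
Let M_triv : trivIset M. Proof. by case/andP: M_match. Qed.

Lemma matching_edge E : E \in M -> exists i j, e i j /\ E = [set i; j].
Proof.
case/andP: M_match => /subsetP Me _ /Me.
by rewrite inE => /existsP[i /existsP[j /andP[eij /eqP->]]]; exists i, j.
Qed.

Lemma cover_edge i j : i \in cover M -> j \in cover M -> e i j -> [set i; j] \in M.
Proof.
case/bigcupP=> a aM ia /bigcupP[b bM jb] eij.
case/andP: M_ind => _ /forall_inP/(_ _ aM)/forall_inP/(_ _ bM)/forall_inP h.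
apply/negPn/negP=> nM; have F : [set i; j] \in edges e :\: M.
  rewrite inE nM inE; apply/existsP; exists i; apply/existsP; exists j.
  by rewrite eij eqxx.
case/negP: (h _ F).
by apply/subsetP=> k /set2P[]->; rewrite inE ?ia ?jb ?orbT.
Qed.

Lemma uncovered_indep i j : i \in R -> j \in R -> ~~ e i j.
Proof.
rewrite !inE => iM jM; apply/negP=> eij.
have [mM' sM'] := matching_setU1 M_match eij iM jM.
by have := M_max mM'; rewrite sM' ltnn.
Qed.

Lemma block_eq E E' i : E \in M -> E' \in M -> i \in E -> i \in E' -> E = E'.
Proof. by move=> EM EM' iE iE'; rewrite -(def_pblock M_triv EM iE) (def_pblock M_triv EM' iE'). Qed.

(* If no orientation is dominated, the edge is the middle of an augmenting path
   of length three. *)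
Lemma dominated_edge E : E \in M ->
  exists x y, [/\ E = [set x; y], e x y & forall w, e y w -> w != x -> e x w].
Proof.
move=> EM; have [a [b [eab Eab]]] := matching_edge EM.
have aE : a \in E by rewrite Eab set21.
have bE : b \in E by rewrite Eab set22.
have ab : a != b by apply: contraTneq eab => ->; rewrite e_irr.
(* Since M is induced, a covered neighbour of an end of E would form an edge of M with it, so it
   would lie in E. *)
have outside c w : c \in E -> e c w -> w \notin E -> w \notin cover M.
  move=> cE ecw wE; apply/negP=> wM.
  have cM : c \in cover M by apply/bigcupP; exists E.
  have F := cover_edge cM wM ecw.
  by have EF := block_eq EM F cE (set21 _ _); rewrite EF set22 in wE.
case: (boolP [exists w, [&& e b w, w != a & ~~ e a w]]) => [|/existsPn h]; last first.
  exists a, b; split=> // w ebw wa; have := h w; rewrite ebw wa /=; exact: negbNE.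
case: (boolP [exists w, [&& e a w, w != b & ~~ e b w]]) => [|/existsPn h _]; last first.
  exists b, a; split=> [||w eaw wb]; first by rewrite setUC.
    by rewrite e_sym.
  by have := h w; rewrite eaw wb /=; exact: negbNE.
case/existsP=> r2 /and3P[ea2 r2b neb2] /existsP[r1 /and3P[eb1 r1a nea1]].
have r2E : r2 \notin E.
  by rewrite Eab !inE negb_or r2b andbT; apply: contraTneq ea2 => ->; rewrite e_irr.
have r1E : r1 \notin E.
  by rewrite Eab !inE negb_or r1a /=; apply: contraTneq eb1 => ->; rewrite e_irr.
have r2M := outside _ _ aE ea2 r2E; have r1M := outside _ _ bE eb1 r1E.
have r12 : r1 != r2 by apply: contraTneq eb1 => ->.
have sD : cover (M :\ E) \subset cover M.
  by apply/bigcupsP=> F; rewrite inE => /andP[_ FM]; apply: bigcup_sup.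
have nD c : c \in E -> c \notin cover (M :\ E).
  move=> cE; apply/negP=> /bigcupP[F]; rewrite !inE => /andP[FE FM] cF.
  by rewrite (block_eq FM EM cF cE) eqxx in FE.
have nR r : r \notin cover M -> r \notin cover (M :\ E) by apply: contra => /(subsetP sD).
have mD : matching e (M :\ E).
  case/andP: M_match => Me _; rewrite /matching (subset_trans (subsetDl _ _) Me) /=.
  exact: trivIsetD.
have [m1 s1] := matching_setU1 mD ea2 (nD _ aE) (nR _ r2M).
have cov2 c : c \notin cover (M :\ E) -> c != a -> c != r2 ->
    c \notin cover ([set a; r2] |: (M :\ E)).
  move=> cD ca cr; apply/negP=> /bigcupP[F]; rewrite in_setU1 => /orP[/eqP->|FD] cF.
    by move: cF; rewrite !inE (negPf ca) (negPf cr).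
  by case/negP: cD; apply/bigcupP; exists F.
have br2 : b != r2 by apply: contraNneq r2E => <-.
have ba : b != a by rewrite eq_sym.
have [m2 s2] := matching_setU1 m1 eb1 (cov2 _ (nD _ bE) ba br2) (cov2 _ (nR _ r1M) r1a r12).
by have := M_max m2; rewrite s2 s1 (cardsD1 E M) EM add1n ltnn.
Qed.

Definition full_edges A := [set E in M | E \subset A].

Lemma tau_full x y A : [set x; y] \in M -> e x y ->
  (forall w, e y w -> w != x -> e x w) -> [set x; y] \subset A ->
  tau A = (tau (A :\ x)).+1 /\ full_edges (A :\ x) = full_edges A :\ [set x; y].
Proof.
move=> EM exy dom EA; split.
  by apply: (tau_dominated exy dom); apply: (subsetP EA); rewrite !inE eqxx ?orbT.
apply/setP=> F; rewrite !inE subsetD1; case: (boolP (F \in M)) => FM /=; last by rewrite andbF.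
rewrite andbC; congr (_ && _); case: eqP => [->|FE]; first by rewrite set21.
by apply/negP=> xF; apply: FE; apply: (block_eq FM EM xF (set21 _ _)).
Qed.

(** A loop over Z stays a loop over C. Removing from both sets the dominating end of an edge of M
    contained in Z lowers all four cover numbers by one; when no such edge is left, the graph on C
    and v is bipartite, between its covered and uncovered vertices. *)
Lemma tau_rank Z C v : Z \subset C -> C :\: Z \subset R -> v \in R ->
  tau (v |: Z) = tau Z -> tau (v |: C) = tau C.
Proof.
have [k] := ubnP #|full_edges Z|; elim: k Z C => // k IHk Z C sk ZC CZR vR tauv.
have [F0|[E]] := set_0Vmem (full_edges Z); last first.
  rewrite inE => /andP[EM EZ]; have [x [y [Exy exy dom]]] := dominated_edge EM.
  subst E; have xM : x \in cover M by apply/bigcupP; exists [set x; y]; rewrite ?set21.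
  have xv : v != x by apply: contraTneq vR => ->; rewrite inE xM.
  have D1 A : (v |: A) :\ x = v |: (A :\ x).
    by apply/setP=> w; rewrite !inE; case: eqP => // ->; rewrite eq_sym (negPf xv).
  have EvZ := subset_trans EZ (subsetUr [set v] Z).
  have EC := subset_trans EZ ZC; have EvC := subset_trans EC (subsetUr [set v] C).
  have [tZ fZ] := tau_full EM exy dom EZ; have [tvZ _] := tau_full EM exy dom EvZ.
  have [tC _] := tau_full EM exy dom EC; have [tvC _] := tau_full EM exy dom EvC.
  rewrite tvC tC D1; congr _.+1; apply: (IHk (Z :\ x)) => //.
  - by move: sk; rewrite fZ (cardsD1 [set x; y] (full_edges Z)) inE EM EZ.
  - exact: setSD.
  - apply/subsetP=> w; rewrite !inE => /and3P[h1 h2 h3]; move: h1; rewrite h2 /= => h1.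
    by have := subsetP CZR w; rewrite !inE h1 h3; apply.
  - by move: tauv; rewrite tvZ tZ D1 => -[].
apply/eqP; rewrite eqn_leq [X in _ && X]tauS ?andbT; last exact: subsetUr.
pose P := Z :&: cover M.
have splitM A : A :&: cover M = P -> A = P :|: (A :&: R).
  by move=> <-; rewrite -setIUr setUCr setIT.
have eC : C :&: cover M = P.
  apply/setP=> w; rewrite !inE; case: (boolP (w \in Z)) => wZ /=.
    by rewrite (subsetP ZC).
  apply/negP=> /andP[wC wM]; have := subsetP CZR w.
  by rewrite !inE wZ wC wM => /(_ isT).
rewrite (splitM C eC); apply: (@tau_bipartite P R (Z :&: R)) => //.
- by rewrite disjoints_subset setCK subsetIr.
- move=> i j; rewrite !inE => /andP[iZ iM] /andP[jZ jM]; apply/negP=> eij.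
  have := cover_edge iM jM eij => EM; have : [set i; j] \in full_edges Z.
    by rewrite inE EM; apply/subsetP=> w /set2P[]->.
  by rewrite F0 inE.
- exact: uncovered_indep.
- exact: setSI.
- exact: subsetIr.
- by rewrite -(splitM Z).
Qed.

(** Covered vertices span only edges of M, so this is the cover number of a matching with isolated
    vertices. *)
Lemma tau_cover_sub A : A \subset cover M -> tau A = #|full_edges A|.
Proof.
have [k] := ubnP #|full_edges A|; elim: k A => // k IHk A sk AM.
have [F0|[E]] := set_0Vmem (full_edges A); last first.
  move=> EF; move: (EF); rewrite inE => /andP[EM EA].
  have [x [y [Exy exy dom]]] := dominated_edge EM; subst E.
  have [tA fA] := tau_full EM exy dom EA.
  have sD : #|full_edges A| = #|full_edges (A :\ x)|.+1.
    by rewrite fA (cardsD1 [set x; y]) EF.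
  rewrite tA sD IHk //; first by rewrite -ltnS -sD.
  exact: subset_trans (subsetDl _ _) AM.
rewrite F0 cards0; apply/eqP; rewrite -leqn0 -(cards0 'I_n); apply: tau_le.
apply/coversP=> i j iA jA eij.
have EM := cover_edge (subsetP AM _ iA) (subsetP AM _ jA) eij.
have : [set i; j] \in full_edges A by rewrite inE EM; apply/subsetP=> w /set2P[]->.
by rewrite F0 inE.
Qed.

(** The vertices of Z outside a minimum cover are independent, so at most one lies in each edge of
    M. *)
Lemma card_le_tau Z : Z \subset cover M -> #|Z| <= m + tau Z.
Proof.
move=> ZM; have [C /coversP cC <-] := tau_witness Z.
rewrite -(cardsID C Z) addnC; apply: leq_add; last exact/subset_leq_card/subsetIr.
rewrite -(card_in_imset (f := pblock M)).
  apply: subset_leq_card; apply/subsetP=> E /imsetP[i iZ ->].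
  by apply: pblock_mem; apply: (subsetP ZM); case/setDP: iZ.
move=> i j; rewrite !inE => /andP[iC iZ] /andP[jC jZ] eqb.
have iM := subsetP ZM _ iZ; have jM := subsetP ZM _ jZ.
apply/eqP/negPn/negP=> ij.
have := pblock_mem iM => /matching_edge[a [b [eab Eab]]].
have := iM; rewrite -mem_pblock Eab => i_ab.
have := jM; rewrite -mem_pblock -eqb Eab => j_ab.
have eij : e i j.
  case/set2P: i_ab => ia; case/set2P: j_ab => ja; subst i j => //; rewrite ?eqxx // in ij.
  by rewrite e_sym.
by have := cC i j iZ jZ eij; rewrite (negPf iC) (negPf jC).
Qed.

Lemma card_cover_matching N : N \subset M -> #|cover N| = 2 * #|N|.
Proof.
move=> NM; have /eqP <- : trivIset N by apply: trivIsetS M_triv.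
rewrite mulnC -sum_nat_const; apply: eq_bigr => E EN.
have [a [b [eab ->]]] := matching_edge (subsetP NM _ EN).
by rewrite cards2; case: eqP eab => // ->; rewrite e_irr.
Qed.

(** * Homology of the complexes cut out by a threshold on cover numbers *)

Section Threshold.
Variables (K : fieldType) (s : nat).

(* The Koszul complex, in the multidegree of W, of the colon ideal by the
   product of the variables in Z. *)
Definition tau_complex W Z B := (B \subset W) && (s <= tau ((W :\: B) :|: Z)).

(** A face avoiding v leaves v in its complement, so v may be counted with Z. *)
Lemma tau_complex_del W Z v B : v \in W ->
  tau_complex (W :\ v) (v |: Z) B = (v \notin B) && tau_complex W Z B.
Proof.
move=> vW; rewrite /tau_complex subsetD1 andbA [(_ \subset _) && _]andbC.
case: (boolP (v \in B)) => //= vB; congr (_ && (_ <= tau _)).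
by apply/setP=> w; rewrite !inE; case: eqP => // ->; rewrite vB vW.
Qed.

Lemma tau_complex_link W Z v B : v \in W ->
  tau_complex (W :\ v) Z B = (v \notin B) && tau_complex W Z (v |: B).
Proof.
move=> vW; rewrite /tau_complex subsetD1 subUset sub1set vW setDDl.
by case: (v \notin B); rewrite ?andbF ?andbT.
Qed.

Lemma tau_complex_down W Z v B : tau_complex W Z (v |: B) -> tau_complex W Z B.
Proof.
rewrite /tau_complex subUset => /andP[/andP[_ ->] /leq_trans] /=; apply.
by apply: tauS; apply: setSU; apply: setDS; apply: subsetUr.
Qed.

Lemma tau_complex_cone W Z v i : v \in W ->
  (forall B, v \notin B -> s <= tau ((W :\: B) :|: Z) -> s <= tau ((W :\: (v |: B)) :|: Z)) ->
  acyclic K (tau_complex W Z) i.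
Proof.
move=> vW h; apply: (acyclic_cone (v := v)) => B vB.
apply/idP/idP; last exact: tau_complex_down.
by rewrite /tau_complex subUset sub1set vW /= => /andP[-> /(h _ vB)].
Qed.

(** Z alone meets the threshold, so this is the full simplex on W. *)
Lemma tau_complex_full W Z i : (0 < #|W|)%N -> s <= tau Z -> acyclic K (tau_complex W Z) i.
Proof.
case/card_gt0P=> v vW sZ; apply: (tau_complex_cone vW) => B _ _.
by apply: leq_trans sZ _; apply: tauS; apply: subsetUr.
Qed.

Lemma acyclic_del_link_tau W Z v i : v \in W ->
  acyclic K (tau_complex (W :\ v) (v |: Z)) i ->
  (forall j, i = j.+1 -> acyclic K (tau_complex (W :\ v) Z) j) ->
  acyclic K (tau_complex W Z) i.
Proof.
move=> vW aE aL.
apply: (@acyclic_del_link n K (tau_complex W Z) (tau_complex (W :\ v) (v |: Z))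
  (tau_complex (W :\ v) Z) v) aE aL => B; rewrite ?tau_complex_del ?tau_complex_link //.
by move=> _; apply: tau_complex_down.
Qed.

Lemma not_acyclic_del_tau W Z v i : v \in W ->
  acyclic K (tau_complex (W :\ v) Z) i ->
  ~ acyclic K (tau_complex (W :\ v) (v |: Z)) i -> ~ acyclic K (tau_complex W Z) i.
Proof.
move=> vW aL naE.
apply: (@not_acyclic_del n K (tau_complex W Z) (tau_complex (W :\ v) (v |: Z))
  (tau_complex (W :\ v) Z) v) aL naE => B; rewrite ?tau_complex_del ?tau_complex_link //.
by move=> _; apply: tau_complex_down.
Qed.

Lemma not_acyclic_link_tau W Z v i : v \in W ->
  acyclic K (tau_complex (W :\ v) (v |: Z)) i ->
  ~ acyclic K (tau_complex (W :\ v) Z) i -> ~ acyclic K (tau_complex W Z) i.+1.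
Proof.
move=> vW aE naL.
apply: (@not_acyclic_link n K (tau_complex W Z) (tau_complex (W :\ v) (v |: Z))
  (tau_complex (W :\ v) Z) v) aE naL => B; rewrite ?tau_complex_del ?tau_complex_link //.
by move=> _; apply: tau_complex_down.
Qed.

(* On uncovered vertices tau is a matroid rank function, and the sets of rank
   at least s span an ideal with linear resolution. *)
Lemma acyclic_uncovered W Z i : W \subset R -> tau Z <= s -> s + i < #|W| + tau Z ->
  acyclic K (tau_complex W Z) i.
Proof.
have [k] := ubnP #|W|; elim: k W Z i => // k IHk W Z i Wk WR Zs si.
have [sZ|sZ] := leqP s (tau Z); first by apply: tau_complex_full => //; lia.
have /card_gt0P[v vW] : (0 < #|W|)%N by lia.
have sW : #|W| = #|W :\ v|.+1 by rewrite (cardsD1 v W) vW.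
have WvR : W :\ v \subset R by apply: subset_trans WR; apply: subsetDl.
have vR := subsetP WR _ vW.
(* If v is a loop over Z, [tau_rank] makes it a cone point. Otherwise the deletion raises [tau Z] by
   one while |W| drops by one, and the link lowers |W| and i together, so the inequality
   survives. *)
have [tv|tv] := eqVneq (tau (v |: Z)) (tau Z).
  apply: (tau_complex_cone vW) => B vB.
  rewrite -(@tau_rank Z (W :\: (v |: B) :|: Z) v) //.
  - move/leq_trans; apply; apply: tauS; apply/subsetP=> w; rewrite !inE.
    by case: eqP => //= _ /orP[->|->]; rewrite ?orbT.
  - exact: subsetUr.
  - apply/subsetP=> w; rewrite !inE => /andP[wZ]; rewrite (negPf wZ) orbF => /andP[_ wW].
    by have := subsetP WR _ wW; rewrite inE.
have tv' : tau (v |: Z) = (tau Z).+1.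
  by apply/eqP; rewrite eqn_leq tauU1 ltn_neqAle eq_sym tv tauS ?subsetUr.
have Wk' : #|W :\ v| < k by rewrite -ltnS -sW.
apply: (acyclic_del_link_tau vW) => [|j ij]; apply: IHk => //.
- by rewrite tv'.
- by move: si; rewrite tv' sW addnS addSn.
- by move: si; rewrite ij sW addnS addSn.
Qed.

Lemma acyclic_tau W Z i : Z \subset cover M -> [disjoint W & Z] -> tau Z <= s ->
  s + m + i < #|W| + #|Z| -> acyclic K (tau_complex W Z) i.
Proof.
have [k] := ubnP #|W|; elim: k W Z i => // k IHk W Z i Wk ZM WZ Zs si.
have := card_le_tau ZM => Zm.
(* Once W has no covered vertex, bounding |Z| by |M| + tau Z leaves exactly the inequality of the
   matroid case. *)
have [W0|[v]] := set_0Vmem (W :&: cover M).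
  by apply: acyclic_uncovered => //; [rewrite -disjoints_subset -setI_eq0 W0 | lia].
rewrite inE => /andP[vW vM].
have W0 : (0 < #|W|)%N by apply/card_gt0P; exists v.
have [sZ|sZ] := leqP s (tau Z); first exact: tau_complex_full.
have sW : #|W| = #|W :\ v|.+1 by rewrite (cardsD1 v W) vW.
have vZ : v \notin Z by rewrite (disjointFr WZ).
have dW : [disjoint W :\ v & Z] by apply: disjointWl WZ; apply: subsetDl.
have Wk' : #|W :\ v| < k by rewrite -ltnS -sW.
apply: (acyclic_del_link_tau vW) => [|j ij]; apply: IHk => //.
- by rewrite subUset sub1set vM.
- by rewrite disjoint_setU1 !inE eqxx.
- exact: leq_trans (tauU1 _ _) _.
- by move: si; rewrite cardsU1 vZ sW addSn add1n addnS.
- by move: si; rewrite ij sW addnS addSn.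
Qed.

(** The empty face is a cycle that no vertex is there to bound; for a monomial ideal it is a minimal
    generator. *)
Lemma not_acyclic_minimal (D : {set 'I_n} -> bool) :
  D set0 -> (forall v, ~~ D [set v]) -> ~ acyclic K D 0.
Proof.
move=> D0 D1 aD; pose c B : K^o := ((B == set0)%:R)%R.
have [B|B|b bD bc] := aD c.
- by rewrite /c; case: (B =P set0) => [->|]; rewrite ?cards0 ?eqxx.
- rewrite /kdiff big1 // => v _; rewrite /c (_ : _ == _ = false) ?GRing.scaler0 //.
  by apply/negbTE/set0Pn; exists v; rewrite setU11.
have := bc set0; rewrite /c eqxx /kdiff big1 => [/esym/eqP|v _]; first by rewrite GRing.oner_eq0.
case: (eqVneq (b (v |: set0)) 0%R) => [->|/bD[Dv _]]; first by rewrite GRing.scaler0.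
by have := D1 v; rewrite -(setU0 [set v]) Dv.
Qed.

(** Each step deletes one end of an edge of N into Z and passes to the link of the other, trading an
    edge of N for a homological degree and keeping |N| + |Z| = |M|. At |N| = s the empty face
    carries the class. *)
Lemma not_acyclic_pairs N Z i : (0 < s)%N -> N \subset M -> Z \subset cover M -> tau Z = 0 ->
  [disjoint cover N & Z] -> #|N| + #|Z| = m -> #|N| = i + s ->
  ~ acyclic K (tau_complex (cover N) Z) i.
Proof.
move=> s0; elim: i N Z => [|i IHi] N Z NM ZM Z0 NZ sNZ sN.
  have CNM : cover N \subset cover M.
    by apply/bigcupsP=> E EN; apply: bigcup_sup; apply: (subsetP NM).
  apply: not_acyclic_minimal => [|v].
    rewrite /tau_complex sub0set setD0 -[s]add0n -sN; apply: tau_matching.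
      exact: trivIsetS NM M_triv.
    move=> E EN; have [a [b [eab Eab]]] := matching_edge (subsetP NM _ EN).
    exists a, b; split=> //; apply: subset_trans (subsetUl _ _).
    exact: bigcup_sup.
  apply/negP; rewrite /tau_complex sub1set => /andP[vN].
  have vM := subsetP CNM _ vN.
  (* An edge of M left in this set is not contained in Z, so it belongs to N; the edge through v is
     lost, and at most s - 1 remain. *)
  rewrite tau_cover_sub; last first.
    by rewrite subUset ZM andbT; apply: subset_trans CNM; apply: subsetDl.
  rewrite leqNgt => /negP[]; case/bigcupP: (vN) => Ev EvN vEv.
  rewrite (leq_trans (n := #|N|)) //; last by rewrite sN.
  rewrite (cardsD1 Ev N) EvN add1n ltnS; apply: subset_leq_card.
  apply/subsetP=> E; rewrite !inE => /andP[EM EW].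
  have vE : v \notin E.
    by apply/negP=> /(subsetP EW); rewrite !inE eqxx /= (disjointFr NZ vN).
  have -> /= : E != Ev by apply: contraNneq vE => ->.
  have [k kE kZ] : exists2 k, k \in E & k \notin Z.
    apply/subsetPn/negP=> EZ; have := tau_cover_sub ZM; rewrite Z0 => /esym/eqP.
    rewrite cards_eq0 => /eqP/setP/(_ E); rewrite !inE EM EZ //.
  have := subsetP EW _ kE; rewrite !inE (negPf kZ) orbF => /andP[_ /bigcupP[E' E'N kE']].
  by rewrite (block_eq EM (subsetP NM _ E'N) kE kE').
have /card_gt0P[E EN] : (0 < #|N|)%N by rewrite sN.
have EM := subsetP NM _ EN; have [x [y [Exy exy dom]]] := dominated_edge EM.
have xy : x != y by apply: contraTneq exy => ->; rewrite e_irr.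
have xE : x \in E by rewrite Exy set21.
have yE : y \in E by rewrite Exy set22.
have inN k : k \in E -> k \in cover N by move=> kE; apply/bigcupP; exists E.
have inM k : k \in E -> k \in cover M by move=> kE; apply/bigcupP; exists E.
have xN := inN _ xE; have yN := inN _ yE.
pose N' := N :\ E.
have sN' : #|N| = #|N'|.+1 by rewrite (cardsD1 E N) EN.
have CN : cover N :\ x :\ y = cover N'.
  apply/setP=> k; rewrite !inE; apply/and3P/bigcupP=> [[ky kx /bigcupP[F FN kF]]|[F]].
    exists F => //; rewrite !inE FN andbT; apply: contraTneq kF => ->.
    by rewrite Exy !inE negb_or kx ky.
  rewrite !inE => /andP[FE FN] kF.
  have nkE : k \notin E.
    by apply: contraNN FE => kE; rewrite (block_eq (subsetP NM _ FN) EM kF kE).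
  split; [by apply: contraNneq nkE => -> | by apply: contraNneq nkE => -> |].
  by apply/bigcupP; exists F.
have yNx : y \in cover N :\ x by rewrite !inE eq_sym xy.
have xZ : x \notin Z by rewrite (disjointFr NZ).
have yZ : y \notin Z by rewrite (disjointFr NZ).
have N'Z : [disjoint cover N' & Z].
  by rewrite -CN; apply: disjointWl NZ; rewrite (subset_trans (subsetDl _ _)) ?subsetDl.
have fullx (A : {set 'I_n}) : A \subset cover M -> y \notin A -> full_edges (x |: A) = full_edges A.
  move=> AM yA; apply/setP=> F; rewrite !inE; case: (boolP (F \in M)) => FM //=.
  apply/idP/idP=> [FA|]; last by move/subset_trans; apply; apply: subsetUr.
  apply/subsetP=> w wF; have := subsetP FA _ wF; rewrite in_setU1.
  case: eqP => //= wx; subst w; have FE := block_eq FM EM wF xE; subst F.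
  by have := subsetP FA _ yE; rewrite !inE eq_sym (negPf xy) (negPf yA).
have xZM : x |: Z \subset cover M by rewrite subUset sub1set inM.
have txZ : tau (x |: Z) = 0.
  by rewrite tau_cover_sub // fullx // -tau_cover_sub.
have CNM : cover N \subset cover M.
  by apply/bigcupsP=> F FN; apply: bigcup_sup; apply: (subsetP NM).
apply: (not_acyclic_del_tau xN).
(* In the link of x the edge through y can no longer be full, so y is a cone point. *)
- apply: (tau_complex_cone yNx) => B yB /leq_trans; apply.
  set A := (cover N :\ x) :\: (y |: B) :|: Z.
  have sA : A \subset cover M.
    rewrite subUset ZM andbT; apply: subset_trans CNM.
    by rewrite (subset_trans (subsetDl _ _)) ?subsetDl.
  rewrite (tau_cover_sub sA) tau_cover_sub; last first.
    rewrite subUset ZM andbT; apply: subset_trans CNM.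
    by rewrite (subset_trans (subsetDl _ _)) ?subsetDl.
  apply: subset_leq_card; apply/subsetP=> F; rewrite !inE => /andP[FM FA]; rewrite FM /=.
  have yF : y \notin F.
    apply/negP=> yF; have FE := block_eq FM EM yF yE; subst F.
    by have := subsetP FA _ xE; rewrite !inE eqxx (negPf xZ) andbF.
  apply/subsetP=> w wF; have := subsetP FA _ wF; rewrite !inE.
  by case: (eqVneq w y) => [wy|]; [rewrite -wy wF in yF|].
apply: (not_acyclic_link_tau yNx).
(* With x and y both in the second set, the sizes add up to s + |M| + i + 1, just past the vanishing
   bound, and the cover number of that set is at most 1 <= s. *)
- rewrite CN; apply: acyclic_tau.
  + by rewrite subUset sub1set inM.
  + by rewrite !disjoint_setU1 N'Z -CN !inE !eqxx /= andbF.
  + by apply: leq_trans (tauU1 _ _) _; rewrite txZ.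
  rewrite !cardsU1 !inE negb_or yZ xZ eq_sym xy /=.
  have -> : #|cover N'| = (2 * #|N'|)%N.
    by apply: card_cover_matching; apply: subset_trans NM; apply: subsetDl.
  move: sNZ sN; rewrite sN' => <-.
  move: #|N'| #|Z| => p q; clear; lia.
rewrite CN; apply: IHi => //.
- by apply: subset_trans NM; apply: subsetDl.
- by rewrite disjoint_setU1 N'Z -CN !inE eqxx /= andbF.
- by rewrite cardsU1 xZ addnCA -sNZ sN'.
- by move: sN; rewrite sN' addSn => -[].
Qed.

(** Add uncovered vertices that raise the rank. If this stops early, every uncovered vertex is a
    loop over the set reached, so by [tau_rank] the whole graph has rank |M| + |A| < s, a
    contradiction. *)
Lemma exists_independent_uncovered : m <= s -> s <= tau setT ->
  exists A, [/\ A \subset R, #|A| = s - m & s <= tau (cover M :|: A)].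
Proof.
move=> ms sT.
have tM : tau (cover M) = m.
  rewrite tau_cover_sub //; apply: eq_card => E; rewrite !inE.
  by case: (boolP (E \in M)) => //= EM; apply: bigcup_sup.
pose P A := [&& A \subset R, tau (cover M :|: A) == m + #|A| & #|A| <= s - m].
have P0 : P set0 by rewrite /P sub0set setU0 tM cards0 addn0 eqxx.
case: (arg_maxnP (fun A : {set 'I_n} => #|A|) P0) => A /and3P[AR /eqP tA sA] maxA.
have [sA'|] := eqVneq #|A| (s - m).
  by exists A; split=> //; rewrite tA sA'; lia.
move=> nsA; have {nsA} sA' : #|A| < s - m by rewrite ltn_neqAle nsA.
have ext v : v \in R -> tau (v |: (cover M :|: A)) = tau (cover M :|: A).
  move=> vR; have [vA|vA] := boolP (v \in A).
    by congr tau; apply/setUidPr; rewrite sub1set inE vA orbT.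
  apply/eqP; rewrite eqn_leq [X in _ && X]tauS ?andbT; last exact: subsetUr.
  rewrite leqNgt; apply/negP=> lt.
  have tv : tau (v |: (cover M :|: A)) = (m + #|A|).+1.
    by apply/eqP; rewrite eqn_leq -tA tauU1 lt.
  have sv : #|v |: A| = #|A|.+1 by rewrite cardsU1 vA.
  have := maxA (v |: A); rewrite /P subUset sub1set vR AR setUCA tv sv addnS eqxx sA'.
  by move=> /(_ isT) /=; rewrite ltnn.
have all k : forall B, #|B| = k -> B \subset R -> tau (B :|: (cover M :|: A)) = m + #|A|.
  elim: k => [|k IHk] B sB BR.
    by move/eqP: sB; rewrite cards_eq0 => /eqP->; rewrite set0U.
  have /card_gt0P[v vB] : (0 < #|B|)%N by rewrite sB.
  have BvR : B :\ v \subset R by apply: subset_trans BR; apply: subsetDl.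
  have eB : tau ((B :\ v) :|: (cover M :|: A)) = m + #|A|.
    by apply: IHk => //; move: sB; rewrite (cardsD1 v B) vB => -[].
  have -> : B :|: (cover M :|: A) = v |: ((B :\ v) :|: (cover M :|: A)).
    by rewrite [RHS]setUA setD1K.
  rewrite -eB; apply: (@tau_rank (cover M :|: A)); first exact: subsetUr.
  - apply/subsetP=> w; rewrite in_setD => /andP[h]; rewrite in_setU (negPf h) orbF.
    exact: (subsetP BvR).
  - exact: (subsetP BR).
  - by apply: ext; apply: (subsetP BR).
have := all _ R (erefl _) (subxx _); rewrite setUA [R :|: _]setUC setUCr setTU => tT.
move: sT sA'; rewrite tT; move: #|A| #|M| => p q; clear; lia.
Qed.

Lemma exists_not_acyclic : (0 < s)%N -> s <= tau setT ->
  exists W i, #|W| = (i + (s + m))%N /\ ~ acyclic K (tau_complex W set0) i.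
Proof.
move=> s0 sT.
have cM := card_cover_matching (subxx M).
have [ms|ms] := leqP m s; last first.
  (* The value of i solves 2|M| = i + s + |M|. *)
  exists (cover M), (m - s); split; first by rewrite cM; lia.
  apply: not_acyclic_pairs; rewrite ?sub0set ?cards0 ?addn0 //; last lia.
    by apply/eqP; rewrite -leqn0 -(cards0 'I_n); apply: tau_le; apply/coversP=> i; rewrite inE.
  by rewrite -setI_eq0 setI0.
have [A [AR sA tA]] := exists_independent_uncovered ms sT.
have dA : [disjoint cover M & A] by rewrite disjoint_sym -(setCK A) disjoints_subset setCK.
(* The size is 2|M| + (s - |M|), so i = 0. Each vertex is needed to reach rank s: a covered one for
   its edge of M, an uncovered one because |A| = s - |M|. *)
exists (cover M :|: A), 0; split.
  by rewrite cardsU (_ : _ :&: _ = set0) ?cards0 ?cM ?sA; [lia | apply/eqP; rewrite setI_eq0].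
apply: not_acyclic_minimal => [|v]; first by rewrite /tau_complex sub0set setD0 setU0.
apply/negP; rewrite /tau_complex sub1set inE setU0 => /andP[/orP[vM|vA]].
  have -> : (cover M :|: A) :\ v = (cover M :\ v) :|: A.
    by apply/setP=> w; rewrite !inE; case: eqP => // ->; rewrite (disjointFr dA vM).
  apply/negP; rewrite -ltnNge; apply: leq_ltn_trans (tauU _ _) _.
  case/bigcupP: (vM) => E EM vE; rewrite tau_cover_sub ?subsetDl //.
  have : #|full_edges (cover M :\ v)| < m.
    rewrite (cardsD1 E M) EM add1n ltnS; apply: subset_leq_card; apply/subsetP=> F.
    rewrite !inE subsetD1 => /and3P[FM _ vF]; rewrite FM andbT.
    by apply: contraNneq vF => ->.
  lia.
have -> : (cover M :|: A) :\ v = cover M :|: (A :\ v).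
  by apply/setP=> w; rewrite !inE; case: eqP => // ->; rewrite (disjointFl dA vA).
apply/negP; rewrite -ltnNge; apply: leq_ltn_trans (tauU _ _) _.
have tM : tau (cover M) <= m.
  rewrite tau_cover_sub //; apply: subset_leq_card.
  by apply/subsetP=> F; rewrite inE => /andP[].
move: sA tM; rewrite (cardsD1 v A) vA; lia.
Qed.

End Threshold.
End CameronWalker.
End VertexCovers.

Local Open Scope ring_scope.

(** * Koszul homology of monomial ideals *)

Section KoszulMonomial.
Variables (n : nat) (K : fieldType).
Local Notation S := {mpoly K[n]}.
Implicit Types (B X : {set 'I_n}) (a m : 'X_{1..n}).

Notation bdr := (@kdiff n K K^o (fun=> 1)).

Definition koszul q (z : {set 'I_n} -> 'rV[S]_q) := kdiff (fun v => 'X_v) z.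

Lemma mcoeffXM v (p : S) m :
  ('X_v * p)@_m = if (0 < m v)%N then p@_(m - U_(v)) else 0.
Proof.
rewrite mulrC; case: ifPn => mv.
  by rewrite -[in LHS](@submK _ U_(v)%MM m) ?lep1mP -?lt0n // addmC mcoeffMX.
apply: memN_msupp_eq0; rewrite (perm_mem (msuppMX _ _)); apply/negP => /mapP[m' _ mE].
by move: mv; rewrite mE mnmDE mnm1E eqxx.
Qed.

Lemma mesym1U v B : v \notin B -> mesym1 (v |: B) = (U_(v) + mesym1 B)%MM.
Proof.
move=> vB; apply/mnmP=> i; rewrite !mnmE !inE [i == v]eq_sym.
by case: eqP => // <-; rewrite (negPf vB).
Qed.

Lemma lem_mesym1U v B a : v \notin B ->
  (mesym1 (v |: B) <= a)%MM = (0 < a v)%N && (mesym1 B <= a)%MM.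
Proof.
move=> vB; apply/mnm_lepP/andP => [h|[av /mnm_lepP h] i].
  split; first by have := h v; rewrite mnmE setU11.
  apply/mnm_lepP=> i; apply: leq_trans (h i); rewrite !mnmE !inE.
  by case: (i \in B); rewrite ?orbT.
by have := h i; rewrite !mnmE !inE; case: eqP => [->|].
Qed.

(** The basis element e_B has multidegree [mesym1 B]; the test guards the truncated subtraction of
    exponents. *)
Definition multideg_part a (z : {set 'I_n} -> S) B : K^o :=
  if (mesym1 B <= a)%MM then (z B)@_(a - mesym1 B) else 0.

Lemma multideg_partS a q (z : {set 'I_n} -> 'rV[S]_q) k B :
  multideg_part a (fun C => koszul z C 0 k) B = bdr (multideg_part a (fun C => z C 0 k)) B.
Proof.
rewrite /multideg_part; case: ifPn => Ba; last first.
  rewrite /kdiff big1 // => v vB.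
  by rewrite lem_mesym1U // (negPf Ba) andbF scaler0.
rewrite /koszul /kdiff summxE raddf_sum; apply: eq_bigr => v vB /=.
rewrite mxE -mulrA.
have -> : ksgn S v B = (ksgn K v B)%:MP by rewrite /ksgn rmorph_sign.
rewrite mcoeffCM mcoeffXM mulr1 mnmBE mnmE (negPf vB) subn0 lem_mesym1U // Ba andbT.
by case: ifP; rewrite ?mulr0 ?scaler0 // mesym1U // submDA addmC.
Qed.

Definition msup m : {set 'I_n} := [set i | (0 < m i)%N].

(** An ideal generated by squarefree monomials is determined by the supports of its monomials; [U]
    is that family. *)
Definition monomial_ideal (U : {set 'I_n} -> bool) (f : S) :=
  forall m, m \in msupp f -> U (msup m).

Definition multideg_complex U a B :=
  (mesym1 B <= a)%MM && U (msup (a - mesym1 B)).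

Lemma msup_mesym1 X : msup (mesym1 X) = X.
Proof. by apply/setP=> i; rewrite inE mnmE; case: (i \in X). Qed.

Lemma lem_mesym1 B X : (mesym1 B <= mesym1 X)%MM = (B \subset X).
Proof.
apply/mnm_lepP/subsetP => h i; have := h i; rewrite ?mnmE.
  by case: (i \in B) => //; case: (i \in X).
by case: (i \in B) => // ->.
Qed.

Lemma mesym1D B X : B \subset X -> (mesym1 X - mesym1 B)%MM = mesym1 (X :\: B).
Proof.
move=> /subsetP BX; apply/mnmP=> i; rewrite mnmBE !mnmE !inE.
by have := BX i; case: (i \in B); case: (i \in X) => // /(_ isT).
Qed.

Lemma multideg_complex_mesym1 U X B :
  multideg_complex U (mesym1 X) B = (B \subset X) && U (X :\: B).
Proof.
rewrite /multideg_complex lem_mesym1; case: (boolP (B \subset X)) => //= BX.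
by rewrite mesym1D // msup_mesym1.
Qed.

(** Dividing by a variable of exponent at least 2 keeps the support, so v is a cone point. *)
Lemma acyclic_multideg_nonsqfree U a v i : (1 < a v)%N ->
  acyclic K (multideg_complex U a) i.
Proof.
move=> av; apply: (acyclic_cone (v := v)) => B vB.
rewrite /multideg_complex lem_mesym1U // (ltnW av); congr (_ && U _).
apply/setP=> i'; rewrite !inE !mnmBE !mnmE !inE; case: eqP => [->|] //.
by rewrite (negPf vB) subn0 subn_gt0 av (ltnW av).
Qed.

Lemma acyclic_multideg_predT a i : a != 0%MM -> acyclic K (multideg_complex xpredT a) i.
Proof.
move=> a0; have [v av] : exists v, (0 < a v)%N.
  apply/existsP; apply: contraNT a0 => /existsPn h; apply/eqP/mnmP=> v.
  by rewrite mnm0E; apply/eqP; rewrite -leqn0 leqNgt.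
apply: (acyclic_cone (v := v)) => B vB.
by rewrite /multideg_complex lem_mesym1U // av.
Qed.

Lemma sqfree_mesym1 a : (forall v, (a v <= 1)%N) -> a = mesym1 (msup a).
Proof.
move=> a1; apply/mnmP=> i; rewrite mnmE inE; have := a1 i.
by case: (a i) => [|[|]].
Qed.

Lemma mcoeff_mpoly_ge N (c : 'X_{1..n} -> K) m : (N <= mdeg m)%N ->
  (\sum_(m' : 'X_{1..n < N}) c m' *: 'X_[m'])@_m = 0.
Proof.
move=> Nm; rewrite raddf_sum big1 //= => m' _; rewrite mcoeffZ mcoeffX.
case: eqP => [mm'|]; last by rewrite mulr0.
by have := bmdeg m'; rewrite mm' ltnNge Nm.
Qed.

(* Both the Koszul complex and a monomial ideal split into their multidegrees,
   where the Koszul complex becomes a simplicial chain complex. *)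
Lemma koszul_lift U i (z : {set 'I_n} -> 'rV[S]_1) :
  (forall B, z B != 0 -> #|B| = i) ->
  (forall B, monomial_ideal U (z B 0 0)) ->
  (forall B, koszul z B = 0) ->
  (forall a, (exists B, multideg_part a (fun C => z C 0 0) B != 0) ->
     acyclic K (multideg_complex U a) i) ->
  exists w : {set 'I_n} -> 'rV[S]_1,
    [/\ forall B, w B != 0 -> #|B| = i.+1,
        forall B, monomial_ideal U (w B 0 0) & forall B, koszul w B = z B].
Proof.
move=> zi zU z0 aU; pose c a := multideg_part a (fun C => z C 0 0).
(* The third clause makes the filling vanish wherever the cycle does, so only finitely many
   multidegrees contribute to [w]. *)
have [b bP] : exists b : 'X_{1..n} -> {set 'I_n} -> K^o, forall a,
    [/\ chain_on (multideg_complex U a) i.+1 (b a), forall B, bdr (b a) B = c a B &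
        (forall B, c a B = 0) -> forall B, b a B = 0].
  apply: (functional_choice (fun a b => [/\ chain_on (multideg_complex U a) i.+1 b,
    forall B, bdr b B = c a B & (forall B, c a B = 0) -> forall B, b B = 0])) => a.
  case: (boolP [exists B, c a B != 0]) => [/existsP cB|/existsPn cB].
    have [|B|b bD bc] := aU a cB (c a).
    - move=> B; rewrite /c /multideg_part; case: ifPn => Ba; last by rewrite eqxx.
      move=> zB; split; first by rewrite /multideg_complex Ba; apply: (zU B); rewrite mcoeff_msupp.
      by apply: zi; apply: contraNneq zB => ->; rewrite mxE mcoeff0.
    - rewrite -(multideg_partS a z 0) /multideg_part z0 mxE mcoeff0; by case: ifP.
    exists b; split=> // c0; case: cB => B; by rewrite c0 eqxx.
  exists (fun=> 0); split=> // B; first by rewrite eqxx.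
  by rewrite kdiff0; have := cB B; rewrite negbK => /eqP.
pose N0 := \big[maxn/0%N]_(B : {set 'I_n}) msize (z B 0 0).
(* From total degree N on, all parts of z vanish: N0 bounds the degrees of the coefficients, and e_B
   has degree |B| <= n. *)
pose N := (N0 + n.+1)%N.
have cN a B : (N <= mdeg a)%N -> c a B = 0.
  move=> Na; rewrite /c /multideg_part; case: ifPn => // Ba.
  apply: memN_msupp_eq0; apply: msize_mdeg_ge.
  have h1 : leq (msize (z B 0 0)) N0 by rewrite /N0 (bigD1 B) //= leq_maxl.
  have h2 : mdeg a = (mdeg (a - mesym1 B)%MM + #|B|)%N.
    by rewrite -[in LHS](submK Ba) mdegD mdeg_mesym1.
  have h3 : (#|B| <= n)%N by rewrite -[X in (_ <= X)%N](card_ord n) max_card.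
  have Na' : (N0 + n.+1 <= mdeg (a - mesym1 B)%MM + #|B|)%N by rewrite -h2.
  by rewrite (leq_trans h1) // -(leq_add2r n) ltnW // (leq_trans _ (leq_trans Na' _)) ?addnS // leq_add2l.
pose w B : 'rV[S]_1 := const_mx (\sum_(m : 'X_{1..n < N}) (b (m + mesym1 B)%MM B) *: 'X_[m]).
have wE m B : (w B 0 0)@_m = b (m + mesym1 B)%MM B.
  rewrite mxE; have [mN|mN] := ltnP (mdeg m) N.
    exact: (mcoeff_mpoly (fun m => b (m + mesym1 B)%MM B)).
  rewrite (mcoeff_mpoly_ge (fun m => b (m + mesym1 B)%MM B)) //.
  have [_ _ ->] // := bP (m + mesym1 B)%MM => C; apply: cN.
  by rewrite mdegD; apply: leq_trans mN _; apply: leq_addr.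
have wP m B : (w B 0 0)@_m != 0 -> U (msup m) /\ #|B| = i.+1.
  rewrite wE; have [bD _ _] := bP (m + mesym1 B)%MM.
  by move=> /bD[]; rewrite /multideg_complex addmK => /andP[_ ].
exists w; split=> [B|B m|B].
- move=> wB; suff [m /wP[]//] : exists m, (w B 0 0)@_m != 0.
  exists (mlead (w B 0 0)); rewrite mleadc_eq0; apply: contraNneq wB => w0.
  by apply/eqP/rowP=> k; rewrite ord1 w0 mxE.
- by rewrite mcoeff_msupp => /wP[].
apply/rowP=> k; rewrite ord1; apply/mpolyP=> m.
have e1 : multideg_part (m + mesym1 B)%MM (fun C => koszul w C 0 0) B = (koszul w B 0 0)@_m.
  by rewrite /multideg_part lem_addl addmK.
have e2 : c (m + mesym1 B)%MM B = (z B 0 0)@_m by rewrite /c /multideg_part lem_addl addmK.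
rewrite -e1 multideg_partS -e2; have [bD <- _] := bP (m + mesym1 B)%MM.
apply: (@eq_kdiff n K K^o) => C; rewrite /multideg_part; case: ifPn => Ca; first by rewrite wE submK.
by apply/esym/eqP; apply: contraNT Ca => /bD[/andP[]].
Qed.

(** In each coordinate all multidegrees but 0 give a cone. Multidegree 0 contributes only constants
    at i = 0, which the last hypothesis excludes. *)
Lemma koszul_exact q i (z : {set 'I_n} -> 'rV[S]_q) :
  (forall B, z B != 0 -> #|B| = i) -> (forall B, koszul z B = 0) ->
  (i = 0%N -> forall k, (z set0 0 k)@_0%MM = 0) ->
  exists2 w : {set 'I_n} -> 'rV[S]_q,
    (forall B, w B != 0 -> #|B| = i.+1) & forall B, koszul w B = z B.
Proof.
move=> zi z0 zc.
have [w wP] : exists w : 'I_q -> {set 'I_n} -> 'rV[S]_1, forall k,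
    (forall B, w k B != 0 -> #|B| = i.+1) /\ (forall B, koszul (w k) B 0 0 = z B 0 k).
  apply: (@fin_all_exists 'I_q (fun=> {set 'I_n} -> 'rV[S]_1) (fun k w =>
    (forall B, w B != 0 -> #|B| = i.+1) /\ (forall B, koszul w B 0 0 = z B 0 k))) => k.
  pose zk B : 'rV[S]_1 := const_mx (z B 0 k).
  have zkz B : koszul zk B 0 0 = koszul z B 0 k.
    by rewrite /koszul /kdiff !summxE; apply: eq_bigr => v _; rewrite !mxE.
  have [||B||w [wi _ wz]] := @koszul_lift xpredT i zk.
  - by move=> B zB; apply: zi; apply: contraNneq zB => h; rewrite /zk h mxE; apply/eqP/rowP=> l; rewrite !mxE.
  - by [].
  - by apply/rowP=> l; rewrite ord1 zkz z0 !mxE.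
  - move=> a [B aB]; apply: acyclic_multideg_predT; apply: contraNneq aB => a0.
    rewrite /multideg_part; case: ifPn => // Ba.
    have B0 : B = set0.
      apply/setP=> v; move/mnm_lepP: Ba => /(_ v); rewrite a0 mnmE mnm0E inE.
      by case: (v \in B).
    subst B; rewrite mxE a0 mesym1_set0 sub0m; apply/eqP.
    case: (posnP i) => [/zc//|i0]; suff -> : z set0 = 0 by rewrite mxE mcoeff0.
    by apply/eqP; apply: contraLR i0 => /zi; rewrite cards0 => <-.
  by exists w; split=> // B; rewrite wz mxE.
exists (fun B => \row_k w k B 0 0) => B.
  move=> wB; have [k wk] : exists k, w k B != 0.
    apply/existsP; apply: contraNT wB => /existsPn h; apply/eqP/rowP=> k.
    by rewrite !mxE; have := h k; rewrite negbK => /eqP->; rewrite mxE.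
  by have [h _] := wP k; apply: h.
apply/rowP=> k; have [_ <-] := wP k; rewrite /koszul /kdiff !summxE.
by apply: eq_bigr => v _; rewrite !mxE.
Qed.

(* The row u is homogeneous of degree j in the sum of the S(- b k - d). *)
Definition hrow q (b : 'I_q -> nat) d j (u : 'rV[S]_q) :=
  forall k m, m \in msupp (u 0 k) -> (mdeg m + b k + d = j)%N.

(* H_i(x; M) = 0 in degree j.  The chain w need not be homogeneous: for a graded
   M its component of degree j will do. *)
Definition koszul_vanishes q (b : 'I_q -> nat) (M : 'rV[S]_q -> Prop) i j :=
  forall z : {set 'I_n} -> 'rV[S]_q,
    (forall B, z B != 0 -> #|B| = i) -> (forall B, M (z B)) ->
    (forall B, hrow b i j (z B)) -> (forall B, koszul z B = 0) ->
    exists w : {set 'I_n} -> 'rV[S]_q,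
      [/\ forall B, w B != 0 -> #|B| = i.+1, forall B, M (w B)
        & forall B, koszul w B = z B].

(** Multidegrees that are not squarefree are acyclic, leaving the sets X of size j. Conversely a
    simplicial cycle c on X becomes the Koszul cycle with coefficients c_B x^(X - B). *)
Lemma koszul_vanishes_ideal U i j :
  (forall X, #|X| = j -> acyclic K (fun B => (B \subset X) && U (X :\: B)) i) <->
  koszul_vanishes (q := 1) (fun=> 0%N) (fun u => monomial_ideal U (u 0 0)) i j.
Proof.
split=> [aU z zi zU zj z0|van X Xj c cD c0].
  apply: koszul_lift => // a [B]; rewrite /multideg_part; case: ifPn => [Ba zB|]; last by rewrite eqxx.
  have aj : mdeg a = j.
    have := zj B 0 (a - mesym1 B)%MM; rewrite mcoeff_msupp zB => /(_ isT) <-.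
    rewrite -[in LHS](submK Ba) mdegD mdeg_mesym1 addn0 (zi B) //.
    by apply: contraNneq zB => ->; rewrite mxE mcoeff0.
  case: (boolP [exists v, (1 < a v)%N]) => [/existsP[v]|/existsPn h].
    exact: acyclic_multideg_nonsqfree.
  have aX : a = mesym1 (msup a) by apply: sqfree_mesym1 => v; rewrite leqNgt.
  rewrite aX; apply: eq_acyclic (aU (msup a) _); last by rewrite -mdeg_mesym1 -aX.
  by move=> C; rewrite multideg_complex_mesym1.
pose z B : 'rV[S]_1 := const_mx (c B *: 'X_[mesym1 X - mesym1 B]).
have zE B : multideg_part (mesym1 X) (fun C => z C 0 0) B = c B.
  rewrite /multideg_part lem_mesym1; case: ifPn => BX.
    by rewrite mxE mcoeffZ mcoeffX eqxx mulr1.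
  by apply/esym/eqP; apply: contraNT BX => /cD[/andP[]].
have zm B m : m \in msupp (z B 0 0) -> [/\ m = (mesym1 X - mesym1 B)%MM & c B != 0].
  rewrite mxE mcoeff_msupp mcoeffZ mcoeffX mulf_eq0 negb_or => /andP[cB mE]; split=> //.
  by move: mE; case: ((mesym1 X - mesym1 B)%MM =P m) => [->|_] //; rewrite eqxx.
have [||||w [wi wU wz]] := van z.
- move=> B zB; suff /cD[] : c B != 0 by [].
  by apply: contraNneq zB => cB; rewrite /z cB scale0r; apply/eqP/rowP=> l; rewrite !mxE.
- by move=> B m /zm[-> /cD[/andP[BX UX] _]]; rewrite mesym1D // msup_mesym1.
- move=> B k m; rewrite ord1 => /zm[-> /cD[/andP[BX _] Bi]].
  rewrite mesym1D // mdeg_mesym1 addn0 cardsD (setIidPr BX) Bi Xj subnK //.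
  by rewrite -Xj -Bi subset_leq_card.
- move=> B; apply/rowP=> k; rewrite ord1 [RHS]mxE; apply/mpolyP=> m; rewrite mcoeff0.
  have [mX|mX] := eqVneq (m + mesym1 B)%MM (mesym1 X).
    have := c0 B; rewrite -(@eq_kdiff n K K^o _ _ _ _ zE) -multideg_partS /multideg_part.
    by rewrite -mX lem_addl addmK.
  rewrite /koszul /kdiff summxE raddf_sum big1 //= => v vB; rewrite mxE -mulrA.
  have -> : ksgn S v B = (ksgn K v B)%:MP by rewrite /ksgn rmorph_sign.
  rewrite mcoeffCM mcoeffXM; case: ifPn => mv; rewrite ?mulr0 //.
  apply/eqP; rewrite mulf_eq0; apply/orP; right; apply: contraNT mX.
  rewrite -mcoeff_msupp => /zm[mE /cD[/andP[BX _] _]]; apply/eqP.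
  move: mE => /(congr1 (fun a => (a + U_(v) + mesym1 B)%MM)).
  rewrite submK ?lep1mP -?lt0n // => ->.
  by rewrite -addmA -mesym1U // submK // lem_mesym1.
exists (multideg_part (mesym1 X) (fun C => w C 0 0)) => B.
  rewrite /multideg_part lem_mesym1; case: ifPn => BX; last by rewrite eqxx.
  move=> wB; split; last by apply: wi; apply: contraNneq wB => ->; rewrite mxE mcoeff0.
  apply/andP; split=> //; rewrite -[X :\: B]msup_mesym1 -mesym1D //; apply: (wU B); by rewrite mcoeff_msupp.
by rewrite -multideg_partS /multideg_part wz; apply: zE.
Qed.

End KoszulMonomial.

(** * Betti numbers and Koszul homology *)

Section GradedPieces.
Variables (n : nat) (K : fieldType).
Local Notation S := {mpoly K[n]}.
Implicit Types (B : {set 'I_n}) (m : 'X_{1..n}) (f g : S).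

(** The component of degree j in S(-c), which is 0 for j < c. *)
Definition gpart c j f : S := if (c <= j)%N then pihomog mdeg (j - c) f else 0.

Lemma mcoeff_pihomog d f m : (pihomog mdeg d f)@_m = if mdeg m == d then f@_m else 0.
Proof.
rewrite /pihomog raddf_sum /= big_mkcond /=.
rewrite (eq_bigr (fun m' => (if mdeg m == d then 1 else 0) * (f@_m' *: 'X_[m'])@_m)).
  by rewrite -mulr_sumr -raddf_sum -mpolyE; case: ifP; rewrite ?mul1r ?mul0r.
move=> m' _; rewrite mcoeffZ mcoeffX; case: (m' =P m) => [->|mm'].
  by case: ifP; rewrite ?mul1r ?mul0r.
by rewrite !mulr0; case: ifP.
Qed.

Lemma mcoeff_gpart c j f m :
  (gpart c j f)@_m = if (mdeg m + c == j)%N then f@_m else 0.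
Proof.
rewrite /gpart; case: leqP => cj; first by rewrite mcoeff_pihomog -(eqn_add2r c) subnK.
rewrite mcoeff0; case: eqP => // mj; by move: cj; rewrite -mj ltnNge leq_addl.
Qed.

Lemma gpartD c j f g : gpart c j (f + g) = gpart c j f + gpart c j g.
Proof. by rewrite /gpart; case: ifP; rewrite ?linearD ?addr0. Qed.

Lemma gpart0 c j : gpart c j 0 = 0.
Proof. by rewrite /gpart; case: ifP; rewrite ?linear0. Qed.

Lemma gpart_sum I (r : seq I) (F : I -> S) c j :
  gpart c j (\sum_(i <- r) F i) = \sum_(i <- r) gpart c j (F i).
Proof. exact: (big_morph _ (gpartD c j) (gpart0 c j)). Qed.

Lemma gpartM c a d j f g : (forall m, m \in msupp g -> (mdeg m + c = a)%N) ->
  gpart (c + d) j (f * g) = gpart (a + d) j f * g.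
Proof.
move=> ga; apply/mpolyP=> m; rewrite mcoeff_gpart !mcoeffM.
rewrite [LHS](_ : _ = \sum_(k : 'X_{1..n < (mdeg m).+1, (mdeg m).+1} | m == (k.1 + k.2)%MM)
   (if (mdeg m + (c + d) == j)%N then f@_k.1 * g@_k.2 else 0)); last first.
  by case: ifP; rewrite // big1.
apply: eq_bigr => k /eqP mk; rewrite mcoeff_gpart.
have [->|] := eqVneq g@_k.2 0; first by rewrite !mulr0; case: ifP.
rewrite -mcoeff_msupp => /ga <-.
have e1 : mdeg m = (mdeg k.1 + mdeg k.2)%N by rewrite {1}mk mdegD.
have -> : (mdeg m + (c + d) = mdeg k.1 + (mdeg k.2 + c + d))%N by move: e1; lia.
by case: ifP; rewrite ?mul0r.
Qed.

Definition grow q (b : 'I_q -> nat) d j (u : 'rV[S]_q) : 'rV[S]_q :=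
  \row_k gpart (b k + d) j (u 0 k).

Lemma hrow_grow q (b : 'I_q -> nat) d j u : hrow b d j (grow b d j u).
Proof.
move=> k m; rewrite mxE mcoeff_msupp mcoeff_gpart; case: ifP => [/eqP <- _|]; last by rewrite eqxx.
by rewrite addnA.
Qed.

Lemma grow_id q (b : 'I_q -> nat) d j u : hrow b d j u -> grow b d j u = u.
Proof.
move=> uj; apply/rowP=> k; rewrite mxE; apply/mpolyP=> m; rewrite mcoeff_gpart.
case: eqP => // mj; apply/esym/memN_msupp_eq0; apply/negP=> /uj; by rewrite -addnA.
Qed.

Lemma growD q (b : 'I_q -> nat) d j u v : grow b d j (u + v) = grow b d j u + grow b d j v.
Proof. by apply/rowP=> k; rewrite !mxE gpartD. Qed.

Lemma grow0 q (b : 'I_q -> nat) d j : grow b d j 0 = 0.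
Proof. by apply/rowP=> k; rewrite !mxE gpart0. Qed.

Lemma grow_sum q (b : 'I_q -> nat) d j I (r : seq I) P (F : I -> 'rV[S]_q) :
  grow b d j (\sum_(i <- r | P i) F i) = \sum_(i <- r | P i) grow b d j (F i).
Proof. exact: (big_morph _ (growD b d j) (grow0 b d j)). Qed.

Lemma graded_mxP p q (a : 'I_p -> nat) (b : 'I_q -> nat) (A : 'M[S]_(p, q)) :
  graded_mx a b A <-> forall k l m, m \in msupp (A k l) -> (mdeg m + b l = a k)%N.
Proof.
split=> [gA k l m mA|h k l].
  have := gA k l; case: leqP => ba; last by move/eqP=> A0; rewrite A0 msupp0 in mA.
  by move/dhomogP/(_ _ mA) => ->; rewrite subnK.
case: leqP => ba; first by apply/dhomogP=> m /h <-; rewrite addnK.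
rewrite -msupp_eq0; case E: (msupp (A k l)) => [//|m s].
by have := h k l m; rewrite E mem_head => /(_ isT) mk; move: ba; rewrite -mk ltnNge leq_addl.
Qed.

Lemma grow_mulmx p q (a : 'I_p -> nat) (b : 'I_q -> nat) (A : 'M[S]_(p, q)) d j u :
  graded_mx a b A -> grow b d j (u *m A) = grow a d j u *m A.
Proof.
move/graded_mxP=> gA; apply/rowP=> l; rewrite !mxE gpart_sum; apply: eq_bigr => k _.
by rewrite mxE (gpartM (a := a k)) // => m; apply: gA.
Qed.

Lemma growX q (b : 'I_q -> nat) d j v u :
  grow b d j ('X_v *: u) = 'X_v *: grow b d.+1 j u.
Proof.
apply/rowP=> l; rewrite !mxE mulrC (gpartM (a := (b l).+1)); last first.
  by move=> m; rewrite msuppX inE => /eqP->; rewrite mdeg1.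
by rewrite mulrC addSnnS.
Qed.

Lemma growN q (b : 'I_q -> nat) d j u : grow b d j (- u) = - grow b d j u.
Proof. by apply/eqP; rewrite -addr_eq0 -growD addNr grow0. Qed.

Lemma grow_koszul q (b : 'I_q -> nat) i j (w : {set 'I_n} -> 'rV[S]_q) B :
  grow b i j (koszul w B) = koszul (fun C => grow b i.+1 j (w C)) B.
Proof.
rewrite /koszul /kdiff grow_sum; apply: eq_bigr => v _; rewrite -!scalerA /ksgn.
case/boolP: (odd #|[set u in B | (u < v)%N]|) => o;
  rewrite -signr_odd ?o ?(negPf o) ?expr1 ?expr0 ?scaleN1r ?scale1r ?growN growX //.
Qed.

Lemma koszul_mulmx p q (A : 'M[S]_(p, q)) (z : {set 'I_n} -> 'rV[S]_p) B :
  koszul (fun C => z C *m A) B = koszul z B *m A.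
Proof.
by rewrite /koszul /kdiff mulmx_suml; apply: eq_bigr => v _; rewrite -scalemxAl.
Qed.

Lemma eq_koszul q (z z' : {set 'I_n} -> 'rV[S]_q) B :
  (forall C, z C = z' C) -> koszul z B = koszul z' B.
Proof. exact: eq_kdiff. Qed.

Lemma mcoeff0M f g : (f * g)@_0%MM = f@_0%MM * g@_0%MM.
Proof. exact: rmorphM. Qed.

Lemma mcoeff0_koszul q (z : {set 'I_n} -> 'rV[S]_q) B k : (koszul z B 0 k)@_0%MM = 0.
Proof.
rewrite /koszul /kdiff summxE raddf_sum big1 //= => v _.
by rewrite mxE !mcoeff0M mcoeffX mnm1_eq0 mulr0 mul0r.
Qed.

Lemma eq_koszul_vanishes q (b : 'I_q -> nat) (M N : 'rV[S]_q -> Prop) i j :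
  (forall u, M u <-> N u) -> koszul_vanishes b M i j -> koszul_vanishes b N i j.
Proof.
move=> MN van z zi zN zj z0; have [||||w [wi wM wz]] := van z => //.
  by move=> B; apply/MN.
by exists w; split=> // B; apply/MN.
Qed.

Definition mx_image p q (A : 'M[S]_(p, q)) (u : 'rV[S]_q) := exists v, u = v *m A.

(** * Dimension shifting in Koszul homology *)

Section DimensionShift.
Variables (p q : nat) (a : 'I_p -> nat) (b : 'I_q -> nat) (A : 'M[S]_(p, q)).
Hypothesis gA : graded_mx a b A.
Hypothesis minA : forall v : 'rV_p, v *m A = 0 -> forall k, (v 0 k)@_0%MM = 0.

Lemma chain_lift i (y : {set 'I_n} -> 'rV[S]_q) :
  (forall B, y B != 0 -> #|B| = i) -> (forall B, mx_image A (y B)) ->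
  exists2 u : {set 'I_n} -> 'rV[S]_p,
    forall B, u B != 0 -> #|B| = i & forall B, y B = u B *m A.
Proof.
move=> yi yA.
have [u uP] : exists u : {set 'I_n} -> 'rV[S]_p, forall B, y B = u B *m A.
  exact: (@fin_all_exists {set 'I_n} (fun=> 'rV[S]_p) (fun B u => y B = u *m A)).
exists (fun B => if #|B| == i then u B else 0) => B.
  by case: ifP => [/eqP//|_]; rewrite eqxx.
case: eqP => [//|Bi]; rewrite mul0mx; apply/eqP/negPn/negP => /yi; exact: Bi.
Qed.

(** From 0 -> ker A -> S^p -> im A -> 0: the free module has no Koszul homology in positive degree,
    and in degree 0 [minA] makes the map H_0(ker A) -> K^p zero. *)
Lemma koszul_vanishes_shift i j :
  koszul_vanishes b (mx_image A) i.+1 j <-> koszul_vanishes a (fun v => v *m A = 0) i j.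
Proof.
split=> [van z zi zN zj z0|van y yi yA yj y0].
  have [|w wi wz] := koszul_exact zi z0; first by move=> _ k; apply: minA.
  pose w' B := grow a i.+1 j (w B).
  have w'z B : koszul w' B = z B by rewrite -grow_koszul wz grow_id.
  have w'i B : w' B != 0 -> #|B| = i.+1.
    by move=> w0; apply: wi; apply: contraNneq w0 => wB; rewrite /w' wB grow0.
  have [||||y [yi yA yw]] := van (fun B => w' B *m A).
  - by move=> B h; apply: w'i; apply: contraNneq h => ->; rewrite mul0mx.
  - by move=> B; exists (w' B).
  - by move=> B; rewrite -(grow_mulmx _ _ _ gA); apply: hrow_grow.
  - by move=> B; rewrite koszul_mulmx w'z zN.
  have [u ui uA] := chain_lift yi yA.
  exists (fun B => w' B - koszul u B); split=> B.
  - have [->|/w'i //] := eqVneq (w' B) 0.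
    by rewrite sub0r oppr_eq0 => /(kdiff_supp ui).
  - by rewrite mulmxBl -koszul_mulmx -yw -(eq_koszul _ uA) subrr.
  - by rewrite /koszul kdiffB kdiffK subr0; apply: w'z.
have [w wi wA] := chain_lift yi yA.
pose w' B := grow a i.+1 j (w B).
have w'i B : w' B != 0 -> #|B| = i.+1.
  by move=> w0; apply: wi; apply: contraNneq w0 => wB; rewrite /w' wB grow0.
have w'A B : y B = w' B *m A by rewrite -(grow_mulmx _ _ _ gA) -wA grow_id.
have [||||u [ui uA uw]] := van (koszul w').
- exact: kdiff_supp w'i.
- by move=> B; rewrite -koszul_mulmx -(eq_koszul _ w'A); apply: y0.
- by move=> B; rewrite -grow_koszul; apply: hrow_grow.
- by move=> B; rewrite /koszul kdiffK.
have [||//|t ti tw] := @koszul_exact _ _ _ i.+1 (fun B => w' B - u B).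
- move=> B; have [->|/w'i //] := eqVneq (w' B) 0.
  by rewrite sub0r oppr_eq0 => /ui.
- by move=> B; rewrite /koszul kdiffB -/(koszul u B) uw subrr.
exists (fun B => t B *m A); split=> B.
- by move=> h; apply: ti; apply: contraNneq h => ->; rewrite mul0mx.
- by exists (t B).
- by rewrite koszul_mulmx tw mulmxBl uA subr0 w'A.
Qed.

Lemma koszul_set0 (u : 'rV[S]_q) B : koszul (fun C => if C == set0 then u else 0) B = 0.
Proof.
rewrite /koszul /kdiff big1 // => v vB; case: eqP => [vB0|]; last by rewrite scaler0.
by have := setU11 v B; rewrite vB0 inE.
Qed.

End DimensionShift.

(** H_0(x; N) = N / (x_1, ..., x_n) N, and for N = im A minimality makes the classes of the rows of
    A a basis. *)
Lemma koszul_vanishes_gens p q (a : 'I_p -> nat) (b : 'I_q -> nat) (A : 'M[S]_(p, q)) j :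
  graded_mx a b A -> (forall v : 'rV_p, v *m A = 0 -> forall k, (v 0 k)@_0%MM = 0) ->
  koszul_vanishes b (mx_image A) 0 j <-> forall k, a k != j.
Proof.
move=> gA minA; split=> [van k|aj z zi zA zj z0].
  apply/eqP=> akj; pose d : 'rV[S]_p := delta_mx 0 k.
  have [B|B|B|B|w [wi wA wz]] := van (fun B => if B == set0 then d *m A else 0).
  - by case: ifP => [/eqP->|_]; rewrite ?cards0 ?eqxx.
  - by case: ifP => _; [exists d | exists 0; rewrite mul0mx].
  - case: ifP => _ l m; last by rewrite mxE msupp0.
    by rewrite -rowE mxE => /((graded_mxP _ _ _).1 gA) ->; rewrite addn0.
  - exact: koszul_set0.
  have [u _ uA] := chain_lift wi wA.
  have := wz set0; rewrite eqxx (eq_koszul _ uA) koszul_mulmx.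
  move/eqP; rewrite -subr_eq0 -mulmxBl => /eqP/minA/(_ k); rewrite !mxE mcoeffB mcoeff0_koszul.
  by rewrite !eqxx mcoeff1 eqxx sub0r => /eqP; rewrite oppr_eq0 oner_eq0.
have [u uA] := zA set0; pose u' := grow a 0 j u.
have u'A : z set0 = u' *m A by rewrite -(grow_mulmx _ _ _ gA) -uA grow_id.
have [B|B|_ k|w wi wz] := @koszul_exact _ _ _ 0 (fun B => if B == set0 then u' else 0).
- by case: ifP => [/eqP->|_]; rewrite ?cards0 ?eqxx.
- exact: koszul_set0.
- rewrite eqxx mxE mcoeff_gpart mdeg0 add0n addn0; case: eqP => // akj.
  by have := aj k; rewrite akj eqxx.
exists (fun B => w B *m A); split=> B.
- by move=> h; apply: wi; apply: contraNneq h => ->; rewrite mul0mx.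
- by exists (w B).
rewrite koszul_mulmx wz; case: eqP => [->//|/eqP B0]; rewrite mul0mx; apply/esym/eqP.
by apply: contraNT B0 => /zi/eqP; rewrite cards_eq0.
Qed.

Section ResolutionBetti.
Variables (F : graded_free_seq n K) (I : S -> Prop).
Hypothesis minF : minimal_graded_free_resolution F I.

Definition syzygies i : 'rV[S]_(gf_rank F i) -> Prop :=
  match i return 'rV[S]_(gf_rank F i) -> Prop with
  | 0 => fun v => v *m gf_aug F = 0
  | i.+1 => fun v => v *m gf_diff F i = 0
  end.

Let syzygies_image i u : syzygies (i := i) u <-> mx_image (gf_diff F i) u.
Proof. by case: i u => [|i] u; [apply: aug_exact minF u | apply: diff_exact minF i u]. Qed.

Let syzygies_min i u : syzygies (i := i) u -> forall k, (u 0 k)@_0%MM = 0.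
Proof.
move/syzygies_image=> [v ->] k; rewrite mxE raddf_sum big1 //= => l _.
by rewrite mcoeff0M (diff_minimal minF) mulr0.
Qed.

Let syzygies_vanish i p j :
  koszul_vanishes (@gf_shift _ _ F p) (syzygies (i := p)) i j <->
  koszul_vanishes (@gf_shift _ _ F (i + p)) (syzygies (i := i + p)) 0 j.
Proof.
elim: i p => [//|i IHi] p; rewrite addSnnS -IHi.
rewrite -(koszul_vanishes_shift (@diff_graded _ _ _ _ minF p) (@syzygies_min p.+1)).
by split; apply: eq_koszul_vanishes => u; rewrite syzygies_image.
Qed.

(** Both sides detect Tor_i(I, K) in degree j. The left one does not mention [F], so the
    nonvanishing of a Betti number is the same for all minimal resolutions. *)
Lemma koszul_vanishes_shifts i j :
  koszul_vanishes (q := 1) (fun=> 0%N) (fun u : 'rV[S]_1 => I (u 0 0)) i j <->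
  forall k, @gf_shift _ _ F i k != j.
Proof.
have I_im (u : 'rV[S]_1) : I (u 0 0) <-> mx_image (gf_aug F) u.
  rewrite (aug_image minF); split=> [[v uv]|[v ->]]; exists v => //.
  by apply/rowP=> k; rewrite ord1.
have -> : koszul_vanishes (q := 1) (fun=> 0%N) (fun u : 'rV[S]_1 => I (u 0 0)) i j <->
          koszul_vanishes (q := 1) (fun=> 0%N) (mx_image (gf_aug F)) i j.
  by split; apply: eq_koszul_vanishes => u; rewrite I_im.
case: i => [|i].
  exact: (koszul_vanishes_gens j (aug_graded minF) (@syzygies_min 0)).
rewrite (koszul_vanishes_shift (aug_graded minF) (@syzygies_min 0)).
rewrite -[koszul_vanishes _ _ _ _]/(koszul_vanishes (@gf_shift _ _ F 0) (syzygies (i := 0)) i j).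
rewrite syzygies_vanish addn0.
rewrite -(koszul_vanishes_gens j (@diff_graded _ _ _ _ minF i) (@syzygies_min i.+1)).
by split; apply: eq_koszul_vanishes => u; rewrite syzygies_image.
Qed.

End ResolutionBetti.

End GradedPieces.

(** * Existence of minimal resolutions *)

(** While some element of Q lies outside the row space, adding it raises the rank, which is at most
    N. [Q] is an arbitrary proposition, hence the classical case distinction. *)
Lemma subspace_row_space (K : fieldType) N (Q : 'rV[K]_N -> Prop) :
  exists r (B : 'M[K]_(r, N)), (forall k, Q (row k B)) /\ forall x, Q x -> (x <= B)%MS.
Proof.
have main r : (exists r (B : 'M[K]_(r, N)), (forall k, Q (row k B)) /\
    forall x, Q x -> (x <= B)%MS) \/
  exists r' (B : 'M[K]_(r', N)), (forall k, Q (row k B)) /\ (r <= \rank B)%N.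
  elim: r => [|r IHr]; first by right; exists 0%N, 0; split=> // -[].
  case: IHr => [h|[r' [B [QB rB]]]]; first by left.
  case: (classic (forall x, Q x -> (x <= B)%MS)) => [h|]; first by left; exists r', B.
  move=> nh; have [x xQ] := not_all_ex_not _ _ nh; have [Qx /negP xB] := imply_to_and _ _ xQ.
  right; exists (r' + 1)%N, (col_mx B x); split.
    move=> k; rewrite -[k]splitK; case: (split k) => l /=.
      by rewrite rowKu.
    by rewrite rowKd (_ : row l x = x) //; apply/rowP=> c; rewrite mxE ord1.
  apply: leq_ltn_trans rB _; apply: rank_ltmx; rewrite /ltmx.
  by rewrite -!addsmxE addsmxSl addsmx_sub submx_refl /= (negPf xB).
case: (main N.+1) => // -[r' [B [_ rB]]].
by have := leq_trans rB (rank_leq_col B); rewrite ltnn.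
Qed.

Lemma ex_minimal (P : nat -> Prop) : (exists k, P k) ->
  exists2 k, P k & forall l, (l < k)%N -> ~ P l.
Proof.
case=> k; have [l] := ubnP k; elim: l k => // l IHl k kl Pk.
case: (classic (exists2 k', (k' < k)%N & P k')) => [[k' k'k Pk']|h].
  by apply: (IHl k') => //; apply: leq_trans k'k _.
by exists k => // k' k'k Pk'; apply: h; exists k'.
Qed.

Section GradedSubmodules.
Variables (n : nat) (K : fieldType).
Local Notation S := {mpoly K[n]}.

Record graded_submodule q (b : 'I_q -> nat) (M : 'rV[S]_q -> Prop) : Prop := {
  gsub0 : M 0;
  gsubD : forall u v, M u -> M v -> M (u + v);
  gsubZ : forall f u, M u -> M (f *: u);
  gsub_grow : forall d j u, M u -> M (grow b d j u)
}.

Lemma gsub_mulmx q (b : 'I_q -> nat) M p (A : 'M[S]_(p, q)) v :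
  graded_submodule b M -> (forall k, M (row k A)) -> M (v *m A).
Proof.
move=> sM MA; rewrite mulmx_sum_row.
apply: (big_ind M); [exact: gsub0 sM | exact: gsubD sM | move=> k _; exact: (gsubZ sM)].
Qed.

Definition hgens q (b : 'I_q -> nat) (M : 'rV[S]_q -> Prop) (D : 'rV[S]_q -> Prop)
    p (a : 'I_p -> nat) (A : 'M[S]_(p, q)) :=
  [/\ graded_mx a b A, forall k, M (row k A) & forall u, M u -> D u -> mx_image A u].

(** Rows of degree j involve finitely many monomials, so that part of M sits in a finite-dimensional
    coordinate space, where a finite family spans it over K. *)
Lemma hgens_degree q (b : 'I_q -> nat) M j : graded_submodule b M ->
  exists p (a : 'I_p -> nat) (A : 'M[S]_(p, q)), hgens b M (hrow b 0 j) a A.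
Proof.
move=> sM; pose T := ('I_q * 'X_{1..n < j.+1})%type.
pose E (x : 'rV[K]_#|{: T}|) : 'rV[S]_q :=
  \row_k \sum_(m : 'X_{1..n < j.+1}) x 0 (enum_rank (k, m)) *: 'X_[m].
pose Q x := M (E x) /\ hrow b 0 j (E x).
have [r [B [QB QsubB]]] := subspace_row_space Q.
exists r, (fun=> j), (\matrix_(k, l) E (row k B) 0 l); split.
- apply/graded_mxP=> k l m; rewrite mxE => mE.
  by have [_ /(_ l m mE)] := QB k; rewrite addn0.
- move=> k; have [h _] := QB k; rewrite (_ : row k _ = E (row k B)) //.
  by apply/rowP=> l; rewrite !mxE.
move=> u Mu uj; pose x : 'rV[K]_#|{: T}| :=
  \row_t (u 0 (enum_val t : T).1)@_((enum_val t : T).2).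
have Ex : E x = u.
  apply/rowP=> k; rewrite mxE [RHS](@mpolywE _ _ j.+1 (u 0 k)).
    by apply: eq_bigr => m _; rewrite mxE enum_rankK.
  rewrite leqNgt; apply/negP=> lt; have u0 : u 0 k != 0.
    by rewrite -msize_poly_eq0 -lt0n; apply: leq_trans lt.
  have := uj k _ (mlead_supp u0); have := mlead_deg u0; rewrite addn0 => e1 e2.
  by move: lt; rewrite -e1 ltnS -e2 ltnNge leq_addr.
have /submxP[y xy] : (x <= B)%MS by apply: QsubB; rewrite /Q Ex.
exists (map_mx (@mpolyC n K) y); rewrite -Ex xy; apply/rowP=> l; rewrite !mxE.
rewrite (eq_bigr (fun m : 'X_{1..n < j.+1} =>
  \sum_k y 0 k *: (B k (enum_rank (l, m)) *: 'X_[m]))); last first.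
  by move=> m _; rewrite mxE scaler_suml; apply: eq_bigr => k _; rewrite scalerA.
rewrite exchange_big; apply: eq_bigr => k _; rewrite !mxE -scaler_sumr mul_mpolyC.
by congr (_ *: _); apply: eq_bigr => m _; rewrite mxE.
Qed.

Lemma hgens_le q (b : 'I_q -> nat) M D : graded_submodule b M ->
  exists p (a : 'I_p -> nat) (A : 'M[S]_(p, q)),
    hgens b M (fun u => exists2 j, (j < D)%N & hrow b 0 j u) a A.
Proof.
move=> sM; elim: D => [|D [p [a [A [gA MA genA]]]]].
  exists 0%N, (fun=> 0%N), 0; split=> [[]|[]|u _ [] //]; by [].
have [p' [a' [A' [gA' MA' genA']]]] := hgens_degree D sM.
pose c (k : 'I_(p + p')) := match split k with inl l => a l | inr l => a' l end.
exists (p + p')%N, c, (col_mx A A'); split.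
- apply/graded_mxP=> k l m; rewrite mxE /c; case: (split k) => k'.
    exact: ((graded_mxP _ _ _).1 gA).
  exact: ((graded_mxP _ _ _).1 gA').
- move=> k; rewrite -[k]splitK; case: (split k) => l /=; by rewrite ?rowKu ?rowKd.
move=> u Mu [j]; rewrite ltnS leq_eqVlt => /orP[/eqP->|jD] uj.
  have [v ->] := genA' u Mu uj; exists (row_mx 0 v); by rewrite mul_row_col mul0mx add0r.
have [|v ->] := genA u Mu; first by exists j.
by exists (row_mx v 0); rewrite mul_row_col mul0mx addr0.
Qed.

(* Graded Nakayama: H_0(x; M) = M / (x_1, ..., x_n) M, so a bound on its degrees
   bounds the degrees of generators. *)
Lemma hgens_exist q (b : 'I_q -> nat) M D : graded_submodule b M ->
  (forall j, (D < j)%N -> koszul_vanishes b M 0 j) ->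
  exists p (a : 'I_p -> nat) (A : 'M[S]_(p, q)), hgens b M (fun=> True) a A.
Proof.
move=> sM van; have [p [a [A [gA MA genA]]]] := hgens_le D.+1 sM.
exists p, a, A; split=> // u Mu _.
have sI : graded_submodule b (mx_image A).
  split=> [|u1 u2 [v1 ->] [v2 ->]|f u1 [v1 ->]|d j u1 [v1 ->]].
  - by exists 0; rewrite mul0mx.
  - by exists (v1 + v2); rewrite mulmxDl.
  - by exists (f *: v1); rewrite scalemxAl.
  - by exists (grow a d j v1); apply: grow_mulmx.
have hom j : forall u, M u -> hrow b 0 j u -> mx_image A u.
  elim/ltn_ind: j => j IHj {Mu}u Mu uj.
  have [jD|Dj] := leqP j D; first by apply: genA => //; exists j.
  have [B|B|B|B|w [wi wM wz]] := van j Dj (fun B => if B == set0 then u else 0).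
  - by case: ifP => [/eqP->|_]; rewrite ?cards0 ?eqxx.
  - by case: ifP => _ //; apply: gsub0 sM.
  - by case: ifP => _ l m; [apply: uj | rewrite mxE msupp0].
  - exact: koszul_set0.
  have -> : u = koszul (fun C => grow b 1 j (w C)) set0.
    by rewrite -grow_koszul wz eqxx grow_id.
  rewrite /koszul /kdiff; apply: (big_ind (mx_image A)).
  - exact: gsub0 sI.
  - exact: gsubD sI.
  move=> v _; apply: (gsubZ sI); apply: (IHj j.-1).
  - by case: (j) Dj.
  - exact: gsub_grow.
  move=> k m /hrow_grow <-; by rewrite addn1 addn0.
have [N uN] : exists N, forall k m, m \in msupp (u 0 k) -> (mdeg m + b k < N)%N.
  pose c k := msize (u 0 k).
  exists (\sum_k (c k + b k).+1)%N => k m mu.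
  rewrite (bigD1 k) //= addSn ltnS; apply: leq_trans (leq_addr _ _).
  by rewrite leq_add2r ltnW // msize_mdeg_lt.
have -> : u = \sum_(j < N) grow b 0 j u.
  apply/rowP=> k; apply/mpolyP=> m; rewrite summxE raddf_sum /=.
  have [mu|mu] := boolP (m \in msupp (u 0 k)); last first.
    rewrite (memN_msupp_eq0 mu) big1 // => j _.
    by rewrite mxE mcoeff_gpart (memN_msupp_eq0 mu); case: ifP.
  rewrite (bigD1 (Ordinal (uN k m mu))) //= mxE mcoeff_gpart addn0 eqxx.
  rewrite big1 ?addr0 // => j jN; rewrite mxE mcoeff_gpart addn0.
  by case: eqP => // e; case/eqP: jN; apply: val_inj.
apply: (big_ind (mx_image A)).
- exact: gsub0 sI.
- exact: gsubD sI.
by move=> j _; apply: (hom j); [apply: gsub_grow | apply: hrow_grow].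
Qed.

Definition minimal_gens q (b : 'I_q -> nat) (M : 'rV[S]_q -> Prop)
    p (a : 'I_p -> nat) (A : 'M[S]_(p, q)) :=
  [/\ graded_mx a b A, forall u, M u <-> mx_image A u &
      forall v : 'rV_p, v *m A = 0 -> forall k, (v 0 k)@_0%MM = 0].

(** Take the least number of homogeneous generators. If a relation has a nonzero constant term at k,
    its component of degree [a k] has that unit as k-th entry, so generator k is redundant. *)
Lemma minimal_gens_exist q (b : 'I_q -> nat) M D : graded_submodule b M ->
  (forall j, (D < j)%N -> koszul_vanishes b M 0 j) ->
  exists p (a : 'I_p -> nat) (A : 'M[S]_(p, q)), minimal_gens b M a A.
Proof.
move=> sM van.
have [p [a [A [gA MA genA]]] minp] := ex_minimal (hgens_exist sM van).
exists p, a, A; split=> // [u|v vA k].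
  by split=> [Mu|[v ->]]; [apply: genA | apply: gsub_mulmx sM MA].
apply/eqP/negPn/negP=> vk.
have [p' Ep] : exists p', p = p'.+1 by case: (p) k {v vA vk} => [[]//|p' _]; exists p'.
subst p; case: (minp p') => //.
pose c := (v 0 k)@_0%MM; pose v' := grow a 0 (a k) v.
have v'A : v' *m A = 0 by rewrite -(grow_mulmx _ _ _ gA) vA grow0.
have v'k : v' 0 k = c%:MP.
  apply/mpolyP=> m; rewrite mxE mcoeff_gpart addn0 mcoeffC.
  rewrite -{2}[a k]add0n eqn_add2r mdeg_eq0; case: eqP => [->|]; by rewrite ?mulr1 ?mulr0.
exists (fun l => a (lift k l)), (row' k A); split.
- by apply/graded_mxP=> l l' m; rewrite mxE; apply: ((graded_mxP _ _ _).1 gA).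
- move=> l; rewrite (_ : row l (row' k A) = row (lift k l) A) //.
  by apply/rowP=> l'; rewrite !mxE.
move=> u Mu _; have [w ->] := genA u Mu I.
pose w' : 'rV[S]_p'.+1 := w - (w 0 k * (c^-1)%:MP) *: v'.
have -> : w *m A = w' *m A by rewrite mulmxBl -scalemxAl v'A scaler0 subr0.
have w'k : w' 0 k = 0.
  have -> : w' 0 k = w 0 k - (w 0 k * (c^-1)%:MP) * v' 0 k by rewrite /w' !mxE.
  by rewrite v'k -mulrA -mpolyCM mulVf // mulr1 subrr.
exists (\row_l w' 0 (lift k l)); apply/rowP=> l'; rewrite !mxE (bigD1_ord k) //= w'k mul0r add0r.
by apply: eq_bigr => l _; rewrite !mxE.
Qed.

Definition koszul_bounded q (b : 'I_q -> nat) (M : 'rV[S]_q -> Prop) :=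
  forall i, exists D, forall j, (D < j)%N -> koszul_vanishes b M i j.

(** All that one step of the resolution consumes, packaged so that taking kernels can be
    iterated. *)
Record bounded_module := BoundedModule {
  bm_rank : nat;
  bm_shift : 'I_bm_rank -> nat;
  bm_pred : 'rV[S]_bm_rank -> Prop;
  bm_graded : graded_submodule bm_shift bm_pred;
  bm_bounded : koszul_bounded bm_shift bm_pred
}.

Record gens_of (X : bounded_module) := GensOf {
  go_rank : nat;
  go_shift : 'I_go_rank -> nat;
  go_mx : 'M[S]_(go_rank, bm_rank X);
  go_min : minimal_gens (@bm_shift X) (@bm_pred X) go_shift go_mx
}.

Lemma gens_of_inhabited X : exists g : gens_of X, True.
Proof.
have [D van] := bm_bounded X 0.
have [p [a [A gA]]] := minimal_gens_exist (bm_graded X) van.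
by exists (GensOf gA).
Qed.

Definition gens X : gens_of X :=
  proj1_sig (constructive_indefinite_description _ (gens_of_inhabited X)).

Lemma kernel_graded X :
  graded_submodule (@go_shift X (gens X)) (fun v => v *m go_mx (gens X) = 0).
Proof.
have [gA _ _] := go_min (gens X).
split=> [|u v u0 v0|f u u0|d j u u0].
- by rewrite mul0mx.
- by rewrite mulmxDl u0 v0 addr0.
- by rewrite -scalemxAl u0 scaler0.
- by rewrite -(grow_mulmx _ _ _ gA) u0 grow0.
Qed.

Lemma kernel_bounded X :
  koszul_bounded (@go_shift X (gens X)) (fun v => v *m go_mx (gens X) = 0).
Proof.
have [gA imA minA] := go_min (gens X).
move=> i; have [D van] := bm_bounded X i.+1; exists D => j /van h.
by apply/(koszul_vanishes_shift gA minA); apply: eq_koszul_vanishes h => u; rewrite imA.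
Qed.

Definition kernel X := BoundedModule (kernel_graded X) (kernel_bounded X).

Lemma minimal_resolution_exists (I : S -> Prop) :
  graded_submodule (q := 1) (fun=> 0%N) (fun u : 'rV[S]_1 => I (u 0 0)) ->
  koszul_bounded (q := 1) (fun=> 0%N) (fun u : 'rV[S]_1 => I (u 0 0)) ->
  exists F, minimal_graded_free_resolution F I.
Proof.
move=> sI bI; pose X i := iter i kernel (BoundedModule sI bI).
exists (@GradedFreeSeq n K (fun i => go_rank (gens (X i))) (fun i => @go_shift _ (gens (X i)))
  (fun i => go_mx (gens (X i.+1))) (go_mx (gens (X 0%N)))).
have mX i := go_min (gens (X i)).
split=> /=.
- by have [] := mX 0%N.
- by move=> i; have [] := mX i.+1.
- move=> f; have [_ im _] := mX 0%N; have := im (const_mx f); rewrite /= mxE => ->.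
  split=> [[u fu]|[u ->]]; exists u; first by rewrite -fu mxE.
  by apply/rowP=> k; rewrite ord1 mxE.
- by move=> u; have [_ im _] := mX 1%N; apply: im.
- by move=> i u; have [_ im _] := mX i.+2; apply: im.
(* The rows of the next matrix are relations among the present generators, and minimality excludes
   constant terms in relations. *)
move=> i k l; have [_ im _] := mX i.+1; have [_ _ min] := mX i.
have /(im _)/min/(_ l) : mx_image (go_mx (gens (X i.+1))) (row k (go_mx (gens (X i.+1)))).
  by exists (delta_mx 0 k); rewrite -rowE.
by rewrite mxE.
Qed.

End GradedSubmodules.

(** * Symbolic powers of edge ideals *)

Section MonomialIdeals.
Variables (n : nat) (K : fieldType).
Local Notation S := {mpoly K[n]}.
Implicit Types (A B C T : {set 'I_n}) (m : 'X_{1..n}) (f g : S).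

Lemma msupD m1 m2 : msup (m1 + m2) = msup m1 :|: msup m2.
Proof. by apply/setP=> i; rewrite !inE mnmDE addn_gt0. Qed.

Lemma msupU i : msup (U_(i) : 'X_{1..n}) = [set i].
Proof. by apply/setP=> j; rewrite !inE mnm1E eq_sym; case: eqP. Qed.

Lemma monomial_idealX U m : monomial_ideal U ('X_[m] : S) <-> U (msup m).
Proof.
split=> [h|Um m']; first by apply: h; rewrite msuppX mem_head.
by rewrite msuppX inE => /eqP->.
Qed.

Section Upset.
Variable U : {set 'I_n} -> bool.
Hypothesis U_up : forall A B, A \subset B -> U A -> U B.

Lemma monomial_ideal0 : monomial_ideal U (0 : S).
Proof. by move=> m; rewrite msupp0. Qed.

Lemma monomial_idealD f g :
  monomial_ideal U f -> monomial_ideal U g -> monomial_ideal U (f + g).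
Proof. by move=> fU gU m /msuppD_le; rewrite mem_cat => /orP[/fU|/gU]. Qed.

Lemma monomial_idealM f g : monomial_ideal U g -> monomial_ideal U (f * g).
Proof.
move=> gU m /msuppM_le/allpairsP[[m1 m2] /= [_ /gU Um2 ->]].
by apply: U_up Um2; rewrite msupD subsetUr.
Qed.

Lemma ideal_gen_monomial (P : S -> Prop) f :
  (forall g, P g -> monomial_ideal U g) ->
  (forall m, U (msup m) -> exists m1 m2, P 'X_[m2] /\ m = (m1 + m2)%MM) ->
  ideal_gen P f <-> monomial_ideal U f.
Proof.
move=> PU UP; split=> [[k [c [g [gP ->]]]]|fU].
  apply: (big_ind (monomial_ideal U)).
  - exact: monomial_ideal0.
  - exact: monomial_idealD.
  by move=> i _; apply: monomial_idealM; apply: PU.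
have [r rP] : exists r : 'I_(size (msupp f)) -> 'X_{1..n} * 'X_{1..n}, forall i,
    P 'X_[(r i).2] /\ tnth (in_tuple (msupp f)) i = ((r i).1 + (r i).2)%MM.
  apply: (@fin_all_exists _ (fun=> 'X_{1..n} * 'X_{1..n})%type (fun i r =>
    P 'X_[r.2] /\ tnth (in_tuple (msupp f)) i = (r.1 + r.2)%MM)) => i.
  have [|m1 [m2 h]] := UP (tnth (in_tuple (msupp f)) i).
    by apply: fU; apply: mem_tnth.
  by exists (m1, m2).
exists (size (msupp f)), (fun i => f@_(tnth (in_tuple (msupp f)) i) *: 'X_[(r i).1]).
exists (fun i => 'X_[(r i).2]); split=> [i|]; first by have [] := rP i.
rewrite [LHS]mpolyE [LHS]big_tnth; apply: eq_bigr => i _.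
by have [_ e] := rP i; rewrite -scalerAl -mpolyXD -e.
Qed.

End Upset.

Definition meets C A := ~~ [disjoint A & C].

Lemma meets_up C A B : A \subset B -> meets C A -> meets C B.
Proof. by move=> AB; apply: contra; apply: disjointWl. Qed.

Lemma var_idealE C f : var_ideal C f <-> monomial_ideal (meets C) f.
Proof.
apply: (ideal_gen_monomial (@meets_up C)) => [g [i iC ->]|m].
  by apply/monomial_idealX; rewrite msupU /meets disjoints1 negbK.
rewrite /meets -setI_eq0 => /set0Pn[i]; rewrite !inE => /andP[mi iC].
exists (m - U_(i))%MM, U_(i)%MM; split; first by exists i.
by rewrite submK // lep1mP -lt0n.
Qed.

Variables (e : rel 'I_n).
Hypotheses (e_sym : symmetric e) (e_irr : irreflexive e).

Definition has_edge A := [exists i in A, exists j in A, e i j].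

Lemma has_edgeP A : reflect (exists i j, [/\ i \in A, j \in A & e i j]) (has_edge A).
Proof.
apply: (iffP exists_inP) => [[i iA /exists_inP[j jA eij]]|[i [j [iA jA eij]]]].
  by exists i, j.
by exists i => //; apply/exists_inP; exists j.
Qed.

Lemma edge_idealE f : edge_ideal K e f <-> monomial_ideal has_edge f.
Proof.
apply: ideal_gen_monomial => [A B /subsetP AB /has_edgeP[i [j [iA jA eij]]]|g [i [j [eij ->]]]|m].
- by apply/has_edgeP; exists i, j; split=> //; apply: AB.
- rewrite -mpolyXD; apply/monomial_idealX/has_edgeP; exists i, j.
  by rewrite msupD !msupU !inE !eqxx orbT.
case/has_edgeP=> i [j [im jm eij]]; exists (m - (U_(i) + U_(j)))%MM, (U_(i) + U_(j))%MM.
split; first by exists i, j; rewrite mpolyXD.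
rewrite submK //; apply/mnm_lepP=> k; move: im jm; rewrite !inE mnmDE !mnm1E.
case: (i =P k) => [<-|_] im jm; last by case: (j =P k) => [<-|].
by case: (j =P i) eij => // ->; rewrite e_irr.
Qed.

Lemma covers_setTP C : reflect (forall A, has_edge A -> meets C A) (covers e setT C).
Proof.
apply: (iffP (coversP _ _ _)) => [cC A /has_edgeP[i [j [iA jA eij]]]|h i j _ _ eij].
  rewrite /meets -setI_eq0; apply/set0Pn.
  by have /orP[kC|kC] := cC i j (in_setT _) (in_setT _) eij; [exists i | exists j]; rewrite inE kC ?iA ?jA.
have : meets C [set i; j] by apply/h/has_edgeP; exists i, j; rewrite !inE !eqxx orbT.
rewrite /meets -setI_eq0 => /set0Pn[k]; rewrite !inE => /andP[/orP[/eqP->|/eqP->] ->] //.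
by rewrite orbT.
Qed.

Lemma has_edge_setC C : covers e setT C -> ~~ has_edge (~: C).
Proof.
by move/covers_setTP=> h; apply/negP=> /h; rewrite /meets disjoints_subset subxx.
Qed.

Lemma covers_setC A : ~~ has_edge A -> covers e setT (~: A).
Proof.
move=> nA; apply/covers_setTP=> B /has_edgeP[i [j [iB jB eij]]].
rewrite /meets disjoints_subset setCK; apply: contra nA => /subsetP BA.
by apply/has_edgeP; exists i, j; rewrite !BA.
Qed.

Definition minimal_covers := [set C | minset (covers e setT) C].

(** A set without edges is disjoint from some minimal cover. The product of the variables outside C
    witnesses irredundancy, as no other minimal cover is contained in C. *)
Lemma minimal_cover_decomposition :
  irredundant_decomposition (edge_ideal K e) minimal_covers.
Proof.
split=> [f|C]; rewrite ?inE.
  rewrite edge_idealE; split=> [fe C|fC m mf].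
    rewrite inE => /minsetp/covers_setTP cC; apply/var_idealE => m /fe; exact: cC.
  case: (boolP (has_edge (msup m))) => // nA; have [C minC CA] := minset_exists (covers_setC nA).
  have := fC C; rewrite inE => /(_ minC)/var_idealE/(_ m mf).
  by rewrite /meets disjoint_sym disjoints_subset CA.
move=> minC; exists 'X_[mesym1 (~: C)]; split=> [C'|].
  rewrite !inE => /andP[C'C minC']; apply/var_idealE/monomial_idealX.
  rewrite msup_mesym1 /meets disjoint_sym disjoints_subset setCK; apply: contra C'C => C'C.
  by apply/eqP; apply: (minsetinf minC) C'C; apply: minsetp minC'.
rewrite edge_idealE => /monomial_idealX; rewrite msup_mesym1; apply/negP.
by apply: has_edge_setC; apply: minsetp minC.
Qed.

Section PowerOfVariables.
Variable C : {set 'I_n}.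

Definition degC m := (\sum_(i in C) m i)%N.

Definition degC_ge k f := forall m, m \in msupp f -> (k <= degC m)%N.

Lemma degC_geM k l f g : degC_ge k f -> degC_ge l g -> degC_ge (k + l) (f * g).
Proof.
move=> fk gl m /msuppM_le/allpairsP[[m1 m2] /= [/fk h1 /gl h2 ->]].
rewrite /degC (eq_bigr (fun i => (m1 i + m2 i)%N)); last by move=> i _; rewrite mnmDE.
by rewrite big_split leq_add.
Qed.

Lemma degC_ge_ideal_gen k (P : S -> Prop) f :
  (forall g, P g -> degC_ge k g) -> ideal_gen P f -> degC_ge k f.
Proof.
move=> Pk [l [c [g [gP ->]]]]; apply: (big_ind (degC_ge k)).
- by move=> m; rewrite msupp0.
- by move=> f1 f2 h1 h2 m /msuppD_le; rewrite mem_cat => /orP[/h1|/h2].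
by move=> i _; rewrite -[k]add0n; apply: degC_geM => //; apply: Pk.
Qed.

Lemma ideal_pow_degC s f : ideal_pow (var_ideal C) s f -> degC_ge s f.
Proof.
apply: degC_ge_ideal_gen => {}f [g [gC ->]]; elim: s g gC => [|s IHs] g gC.
  by rewrite big_ord0.
rewrite big_ord_recl; apply: (@degC_geM 1 s); last by apply: IHs => i; apply: gC.
apply: degC_ge_ideal_gen (gC ord0) => _ [i iC ->] m; rewrite msuppX inE => /eqP->.
by rewrite /degC (bigD1 i) //= mnm1E eqxx.
Qed.

Lemma var_idealX i : i \in C -> var_ideal C ('X_i : S).
Proof. by move=> iC; apply/var_idealE/monomial_idealX; rewrite msupU /meets disjoints1 negbK. Qed.

Lemma mesym1_ideal_pow s A : (s <= #|A :&: C|)%N ->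
  exists (c : S) (g : 'I_s -> S),
    (forall i, var_ideal C (g i)) /\ 'X_[mesym1 A] = c * \prod_i g i.
Proof.
elim: s A => [|s IHs] A sA.
  by exists 'X_[mesym1 A], (fun=> 0); split=> [[]|]; rewrite ?big_ord0 ?mulr1.
have /card_gt0P[v] : (0 < #|A :&: C|)%N by apply: leq_trans sA.
rewrite inE => /andP[vA vC].
have [|c [g [gC cg]]] := IHs (A :\ v).
  by move: sA; rewrite (cardsD1 v) inE vA vC add1n ltnS setIDAC.
exists c, (fun i => if unlift ord0 i is Some j then g j else 'X_v); split=> [i|].
  by case: unliftP => [j _|_]; [apply: gC | apply: var_idealX].
rewrite big_ord_recl unlift_none (eq_bigr g) => [|i _]; last by rewrite liftK.
by rewrite -{1}(setD1K vA) mesym1U ?inE ?eqxx // mpolyXD cg mulrCA.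
Qed.

Lemma ideal_pow_mesym1 s A :
  ideal_pow (var_ideal C) s ('X_[mesym1 A] : S) <-> (s <= #|A :&: C|)%N.
Proof.
split=> [/ideal_pow_degC/(_ (mesym1 A))|sA].
  rewrite msuppX mem_head => /(_ isT)/leq_trans; apply.
  rewrite /degC -sum1_card [X in (_ <= X)%N](eq_bigl (fun i => (i \in C) && (i \in A))).
    by rewrite big_mkcondr leq_sum // => i _; rewrite mnmE; case: (i \in A).
  by move=> i; rewrite inE andbC.
have [c [g [gC cg]]] := mesym1_ideal_pow sA.
exists 1%N, (fun=> c), (fun=> \prod_i g i); rewrite big_ord1; split=> // _.
by exists g.
Qed.

End PowerOfVariables.

Lemma symbolic_power_mesym1 s A :
  symbolic_power (edge_ideal K e) s ('X_[mesym1 A] : S) <-> (s <= tau e A)%N.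
Proof.
split=> [[D [ID _] DC]|sA].
  (* [D] is any decomposition, so a component inside the cover [C'] must be found: without one, the
     product of the variables outside [C'] would lie in the edge ideal. Within A, that component is
     contained in T. *)
  have [T cT <-] := tau_witness e A; pose C' := T :|: ~: A.
  have cC' : covers e setT C'.
    apply/coversP=> i j _ _ eij; rewrite !inE.
    case: (boolP (i \in A)) => iA; last by rewrite orbT.
    case: (boolP (j \in A)) => jA; last by rewrite !orbT.
    by rewrite !orbF; move/coversP: cT; apply.
  case: (boolP [exists C in D, C \subset C']) => [/exists_inP[C CD CC']|/exists_inPn h].
    have /ideal_pow_mesym1/leq_trans := DC C CD; apply; apply: subset_leq_card.
    apply/subsetP=> i; rewrite inE => /andP[iA iC].
    by have := subsetP CC' i iC; rewrite !inE iA orbF.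
  have : edge_ideal K e 'X_[mesym1 (~: C')].
    apply/ID => C CD; apply/var_idealE/monomial_idealX; rewrite msup_mesym1.
    by rewrite /meets disjoint_sym disjoints_subset setCK; apply: h.
  by move/edge_idealE/monomial_idealX; rewrite msup_mesym1 (negPf (has_edge_setC cC')).
exists minimal_covers; first exact: minimal_cover_decomposition.
move=> C; rewrite inE => /minsetp/coversP cC; apply/ideal_pow_mesym1.
apply: leq_trans sA _; apply: tau_le; apply/coversP=> i j iA jA eij; rewrite !inE iA jA.
by apply: cC; rewrite ?inE.
Qed.

Lemma sqfree_symbolic_powerE s f :
  sqfree_symbolic_power (edge_ideal K e) s f <->
  monomial_ideal (fun A => (s <= tau e A)%N) f.
Proof.
apply: ideal_gen_monomial => [A B AB sA|g [m [sm -> sym]]|m sm].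
- by apply: leq_trans sA _; apply: tauS.
- apply/monomial_idealX; move: sym; rewrite [m in 'X_[m]](sqfree_mesym1 sm).
  by move/symbolic_power_mesym1.
exists (m - mesym1 (msup m))%MM, (mesym1 (msup m)); split.
  exists (mesym1 (msup m)); split=> // [i|]; first by rewrite mnmE leq_b1.
  exact/symbolic_power_mesym1.
rewrite submK //; apply/mnm_lepP=> i; rewrite mnmE inE; by case: (m i).
Qed.

End MonomialIdeals.

(** * Height *)

Section Height.
Variables (n : nat) (K : fieldType).
Local Notation S := {mpoly K[n]}.
Implicit Types (P Q : {pred S}) (f g : S).

Definition peval d (y : 'I_d -> S) (p : {mpoly K[d]}) : S := mmap (@mpolyC n K) y p.

(** Algebraic independence over K of the images of y in S / Q. *)
Definition algebraically_independent Q d (y : 'I_d -> S) :=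
  forall p, peval y p \in Q -> p = 0.

Lemma prime_idealD Q f g : prime_ideal Q -> f \in Q -> g \in Q -> f + g \in Q.
Proof. by move=> [[_ _ h] _] fQ gQ; rewrite -[f]mul1r; apply: h. Qed.

Lemma prime_idealMl Q f g : prime_ideal Q -> g \in Q -> f * g \in Q.
Proof. by move=> [[Q0 _ h] _] gQ; rewrite -[_ * _]addr0; apply: h. Qed.

Lemma prime_ideal0 Q : prime_ideal Q -> 0 \in Q.
Proof. by case=> -[]. Qed.

Lemma prime_idealX Q f g k : prime_ideal Q -> f \notin Q -> f ^+ k * g \in Q -> g \in Q.
Proof.
move=> [_ Qp] fQ; elim: k => [|k IHk]; first by rewrite mul1r.
by rewrite exprS -mulrA => /Qp; rewrite (negPf fQ) => /IHk.
Qed.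

(* After dividing a relation by the largest power of f, its part of degree 0
   in f is a relation modulo Q' among the y's alone. *)
Lemma algebraically_independentS Q Q' f d (y : 'I_d -> S) :
  prime_ideal Q -> prime_ideal Q' -> {subset Q <= Q'} -> f \in Q' -> f \notin Q ->
  algebraically_independent Q' y ->
  algebraically_independent Q (fun i : 'I_d.+1 => if unlift ord0 i is Some j then y j else f).
Proof.
move=> prQ prQ' QQ' fQ' fQ indep p pQ; apply/eqP/negPn/negP=> p0.
pose low (m : 'X_{1..d.+1}) : 'X_{1..d} := [multinom m (lift ord0 j) | j < d].
have ex_k : exists k, has (fun m : 'X_{1..d.+1} => m ord0 == k) (msupp p).
  exists (mlead p ord0); apply/hasP; exists (mlead p); rewrite ?eqxx //.
  exact: mlead_supp.
case: (ex_minnP ex_k) => k /hasP[m0 m0p /eqP m0k] mink.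
have kmin m : m \in msupp p -> (k <= m ord0)%N.
  by move=> mp; apply: mink; apply/hasP; exists m; rewrite ?eqxx.
pose h := \sum_(m <- msupp p) (p@_m)%:MP * (f ^+ (m ord0 - k) * mmap1 y (low m)) : S.
have hQ : h \in Q.
  apply: (prime_idealX (k := k) prQ fQ); suff <- : peval (fun i : 'I_d.+1 =>
    if unlift ord0 i is Some j then y j else f) p = f ^+ k * h by [].
  rewrite /peval /mmap mulr_sumr; apply: eq_big_seq => m /kmin km.
  rewrite mulrCA; congr (_ * _); rewrite mulrA -exprD subnKC // /mmap1 big_ord_recl unlift_none.
  by congr (_ * _); apply: eq_bigr => j _; rewrite liftK mnmE.
pose p' := \sum_(m <- msupp p | m ord0 == k) p@_m *: 'X_[low m].
have p'0 : p' = 0.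
  apply: indep; rewrite [peval _ _](_ : _ = h + - 1 *
     \sum_(m <- msupp p | m ord0 != k) (p@_m)%:MP * (f ^+ (m ord0 - k) * mmap1 y (low m))).
    apply: prime_idealD (QQ' _ hQ) _ => //; apply: prime_idealMl => //; rewrite big_seq_cond.
    apply: (big_ind (fun g => g \in Q')); first exact: prime_ideal0.
      by move=> *; apply: prime_idealD.
    move=> m /andP[/kmin km mk]; apply: prime_idealMl => //; rewrite mulrC.
    apply: prime_idealMl => //.
    have -> : (m ord0 - k = (m ord0 - k).-1.+1)%N by rewrite prednK // subn_gt0 ltn_neqAle eq_sym mk.
    by rewrite exprSr; apply: prime_idealMl.
  rewrite /h (bigID (fun m : 'X_{1..d.+1} => m ord0 == k)) /= mulN1r addrK.
  rewrite /peval raddf_sum /=; apply: eq_bigr => m /eqP mk.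
  by rewrite mmapZ mmapX mk subnn mul1r.
have := mcoeff0 K (low m0); rewrite -{1}p'0 raddf_sum /= => /eqP.
rewrite big_mkcond (bigD1_seq m0) ?msupp_uniq //= m0k eqxx mcoeffZ mcoeffX eqxx mulr1 big1 ?addr0.
  by apply/negP; rewrite -mcoeff_msupp.
move=> m mm0; case: (m ord0 =P k) => // mk; rewrite mcoeffZ mcoeffX.
case: eqP => [lowE|]; last by rewrite mulr0.
case/eqP: mm0; apply/mnmP=> i; case: (unliftP ord0 i) => [j ->|->]; last by rewrite mk m0k.
by have := congr1 (fun m : 'X_{1..d} => m j) lowE; rewrite !mnmE.
Qed.

Definition degree_le k f := forall m, m \in msupp f -> (mdeg m <= k)%N.

Lemma degree_leM k l f g : degree_le k f -> degree_le l g -> degree_le (k + l) (f * g).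
Proof.
move=> fk gl m /msuppM_le/allpairsP[[m1 m2] /= [/fk h1 /gl h2 ->]].
by rewrite mdegD leq_add.
Qed.

Lemma degree_leX k l f : degree_le k f -> degree_le (l * k) (f ^+ l).
Proof.
move=> fk; elim: l => [|l IHl]; last by rewrite exprS mulSn; apply: degree_leM.
by move=> m; rewrite expr0 msupp1 inE => /eqP->; rewrite mdeg0.
Qed.

Lemma degree_le_mmap1 d (y : 'I_d -> S) D N (m : 'X_{1..d}) :
  (forall i, degree_le D (y i)) -> (forall i, (m i <= N)%N) ->
  degree_le (d * (N * D)) (mmap1 y m).
Proof.
move=> yD mN; rewrite /mmap1 -[X in (X * _)%N](card_ord d) -sum_nat_const.
apply: (big_ind2 (fun k f => degree_le k f)).
- by move=> m'; rewrite msupp1 inE => /eqP->; rewrite mdeg0.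
- by move=> ? ? ? ? h1 h2; apply: degree_leM h1 h2.
move=> i _ m' /(degree_leX (yD i)) /leq_trans; apply.
by rewrite leq_mul2r mN orbT.
Qed.

(* There are N^d monomials in the y's with exponents below N, all lying in a
   space of dimension O(N^n). *)
Lemma algebraically_dependent d (y : 'I_d -> S) : (n < d)%N ->
  exists2 p, p != 0 & peval y p = 0.
Proof.
move=> nd; pose D := \max_i msize (y i).
have yD i : degree_le D (y i).
  move=> m /msize_mdeg_lt/ltnW/leq_trans; apply.
  by rewrite /D (bigD1 i) //= leq_maxl.
(* These constants give B <= c N and c^n < N, whence B^n <= c^n N^n < N^(n+1) <= N^d. *)
pose c := (d * D + 1)%N; pose N := (c ^ n).+1.
pose B := (d * (N * D)).+1.
pose G := {ffun 'I_d -> 'I_N}; pose H := {ffun 'I_n -> 'I_B}.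
have lt_card : (#|{: H}| < #|{: G}|)%N.
  rewrite !card_ffun !card_ord.
  have BcN : (B <= c * N)%N.
    by rewrite /B /c mulnDl mul1n (mulnC N) mulnA -addn1 leq_add2l.
  apply: leq_ltn_trans (_ : ((c * N) ^ n < N ^ d)%N).
    by have [->|n0] := posnP n; rewrite ?expn0 // leq_exp2r.
  rewrite expnMn; apply: leq_trans (_ : (N * N ^ n <= N ^ d)%N).
    by rewrite ltn_pmul2r ?expn_gt0.
  by rewrite -expnS leq_pexp2l.
pose gm (g : G) : 'X_{1..d} := [multinom (g i : nat) | i < d].
pose hm (h : H) : 'X_{1..n} := [multinom (h i : nat) | i < n].
pose A : 'M[K]_(#|{: G}|, #|{: H}|) :=
  \matrix_(s, t) (mmap1 y (gm (enum_val s)))@_(hm (enum_val t)).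
have [v v0 vA] : exists2 v : 'rV_#|{: G}|, v != 0 & v *m A = 0.
  have : kermx A != 0.
    rewrite -mxrank_eq0 mxrank_ker subn_eq0 -ltnNge.
    by apply: leq_ltn_trans (rank_leq_col A) _.
  case/rowV0Pn=> v /sub_kermxP vA v0; by exists v.
exists (\sum_s v 0 s *: 'X_[gm (enum_val s)]).
  have [s vs] : exists s, v 0 s != 0.
    apply/existsP; apply: contraNT v0 => /existsPn h; apply/eqP/rowP=> s.
    by rewrite mxE; have := h s; rewrite negbK => /eqP.
  apply: contraNneq vs => p0; have := mcoeff0 K (gm (enum_val s)).
  rewrite -{1}p0 raddf_sum /= (bigD1 s) //= mcoeffZ mcoeffX eqxx mulr1 big1 ?addr0 => [->//|t ts].
  rewrite mcoeffZ mcoeffX; case: eqP => [gE|]; last by rewrite mulr0.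
  case/eqP: ts; apply: enum_val_inj; apply/ffunP=> i; apply: val_inj.
  by have := congr1 (fun m : 'X_{1..d} => m i) gE; rewrite !mnmE.
rewrite /peval raddf_sum /=; apply/mpolyP=> m; rewrite raddf_sum mcoeff0 /=.
have yN s : degree_le (d * (N * D)) (mmap1 y (gm (enum_val s))).
  apply: (degree_le_mmap1 yD) => i; rewrite mnmE; exact: ltnW.
have [mB|mB] := leqP (mdeg m) (d * (N * D)); last first.
  rewrite big1 // => s _; rewrite mmapZ mmapX mcoeffCM memN_msupp_eq0 ?mulr0 //.
  by apply/negP=> /yN; rewrite leqNgt mB.
have miB i : (m i < B)%N.
  by rewrite /B ltnS; apply: leq_trans mB; rewrite mdegE (bigD1 i) //= leq_addr.
pose h : H := [ffun i => Ordinal (miB i)].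
have hmE : hm h = m by apply/mnmP=> i; rewrite mnmE ffunE.
have /rowP/(_ (enum_rank h)) := vA; rewrite !mxE => e0; rewrite -[RHS]e0.
by apply: eq_bigr => s _; rewrite mmapZ mmapX mcoeffCM mxE enum_rankK hmE.
Qed.

Lemma algebraically_independent_size Q d (y : 'I_d -> S) : prime_ideal Q ->
  algebraically_independent Q y -> (d <= n)%N.
Proof.
move=> prQ indep; rewrite leqNgt; apply/negP=> /(algebraically_dependent y)[p p0 yp].
by case/eqP: p0; apply: indep; rewrite yp; apply: prime_ideal0.
Qed.

(** * Height of a prime generated by variables *)

Section VariableIdeal.
Variable C : {set 'I_n}.

Definition kill (f : S) : S := mmap (@mpolyC n K) (fun i => if i \in C then 0 else 'X_i) f.

(** As the kernel of a substitution into a domain, the ideal is a boolean predicate and visibly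
    prime. *)
Definition var_prime : {pred S} := fun f => kill f == 0.

Lemma kill_is_additive : {morph kill : f g / f + g}.
Proof. exact: raddfD. Qed.

Lemma killM : {morph kill : f g / f * g}.
Proof. exact: rmorphM. Qed.

Lemma var_prime_prime : prime_ideal var_prime.
Proof.
split; last first.
  by move=> f g; rewrite !unfold_in /var_prime killM mulf_eq0.
split; rewrite ?unfold_in /var_prime.
- by rewrite /kill raddf0.
- by rewrite /kill rmorph1 oner_eq0.
move=> f g h; rewrite !unfold_in kill_is_additive killM => /eqP-> /eqP->.
by rewrite mulr0 addr0.
Qed.

Lemma algebraically_independent_variables :
  algebraically_independent var_prime (fun j : 'I_#|~: C| => 'X_(enum_val j)).
Proof.
move=> p; pose mm (m : 'X_{1..#|~: C|}) := (\sum_j U_(enum_val j) *+ m j)%MM.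
have mmE m : mmap1 (fun j : 'I_#|~: C| => 'X_(enum_val j)) m = 'X_[mm m] :> S.
  by rewrite /mmap1 mprodXnE.
have mm_at m j : mm m (enum_val j) = m j.
  rewrite mnm_sumE (bigD1 j) //= mulmnE mnm1E eqxx mul1n big1 ?addn0 // => l lj.
  rewrite mulmnE mnm1E; case: eqP => [/enum_val_inj lE|_ //].
  by rewrite lE eqxx in lj.
have pE : peval (fun j : 'I_#|~: C| => 'X_(enum_val j)) p =
    \sum_(m <- msupp p) p@_m *: 'X_[mm m].
  by rewrite /peval /mmap; apply: eq_bigr => m _; rewrite mmE mul_mpolyC.
rewrite unfold_in /var_prime => /eqP kp; apply/eqP/negPn/negP=> p0.
suff : (peval (fun j : 'I_#|~: C| => 'X_(enum_val j)) p)@_(mm (mlead p)) = 0.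
  rewrite pE raddf_sum /= (bigD1_seq (mlead p)) ?msupp_uniq ?mlead_supp //=.
  rewrite mcoeffZ mcoeffX eqxx mulr1 big1 ?addr0 => [/eqP|m mp].
    by rewrite mleadc_eq0 (negPf p0).
  rewrite mcoeffZ mcoeffX; case: eqP => [mE|]; last by rewrite mulr0.
  by case/eqP: mp; apply/mnmP=> j; rewrite -!mm_at mE.
suff <- : kill (peval (fun j : 'I_#|~: C| => 'X_(enum_val j)) p) =
    peval (fun j : 'I_#|~: C| => 'X_(enum_val j)) p by rewrite kp mcoeff0.
rewrite pE /kill raddf_sum /=; apply: eq_bigr => m _; rewrite mmapZ mmapX mul_mpolyC.
congr (_ *: _); rewrite mpolyXE_id; apply: eq_bigr => i _; case: ifPn => // iC.
rewrite (_ : mm m i = 0%N) ?expr0 // mnm_sumE big1 // => j _.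
rewrite mulmnE mnm1E; case: eqP => // ji.
by have := enum_valP j; rewrite ji inE iC.
Qed.

(** The n - |C| variables outside C are independent modulo the top prime, and each step down the
    chain adds one element. The h + n - |C| elements reached at the bottom are at most n. *)
Lemma le_prime_height_var_prime h : le_prime_height h var_prime -> (h <= #|C|)%N.
Proof.
case=> Q [Qprime Qchain Qh].
have indep k : (k <= h)%N ->
    exists y : 'I_(k + #|~: C|) -> S, algebraically_independent (Q (h - k)%N) y.
  elim: k => [_|k IHk kh].
    rewrite subn0; exists (fun j => 'X_(enum_val j)) => p; rewrite Qh.
    exact: algebraically_independent_variables.
  have [y yi] := IHk (ltnW kh); have lt : (h - k.+1 < h)%N by rewrite ltn_subrL (leq_trans _ kh).
  have hk : (h - k = (h - k.+1).+1)%N by rewrite subnSK.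
  have [sub [f fQ nfQ]] := Qchain _ lt.
  exists (fun i : 'I_(k + #|~: C|).+1 => if unlift ord0 i is Some j then y j else f).
  apply: (@algebraically_independentS _ (Q (h - k)%N)) => //.
  - by apply: Qprime; apply: leq_subr.
  - by apply: Qprime; apply: leq_subr.
  - by rewrite hk.
  - by rewrite hk.
have [y yi] := indep h (leqnn h).
have := algebraically_independent_size _ yi; rewrite subnn => /(_ (Qprime 0%N (leq0n h))).
by rewrite cardsCs setCK card_ord => hC; have := max_card (mem C); rewrite card_ord; lia.
Qed.

End VariableIdeal.

(** The prime generated by a minimum vertex cover contains the edge ideal. *)
Lemma le_height_tau (e : rel 'I_n) s :
  le_height s (edge_ideal K e) -> (s <= tau e setT)%N.
Proof.
move=> hs; have [C cC <-] := tau_witness e setT; apply: le_prime_height_var_prime.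
have Cprime := var_prime_prime C.
apply: hs => // f [m [c [g [gI ->]]]].
apply: (big_ind (fun f => f \in var_prime C)).
- exact: prime_ideal0.
- by move=> ? ?; apply: prime_idealD.
move=> k _; apply: prime_idealMl => //; have [i [j [eij ->]]] := gI k.
rewrite unfold_in /var_prime killM /kill !mmapX !mmap1U mulf_eq0.
by have /orP[->|->] := coversP _ _ _ cC i j (in_setT _) (in_setT _) eij; rewrite eqxx ?orbT.
Qed.

End Height.

(** * Regularity *)

Lemma monomial_ideal_graded n (K : fieldType) (U : {set 'I_n} -> bool) :
  (forall A B : {set 'I_n}, A \subset B -> U A -> U B) ->
  graded_submodule (q := 1) (fun=> 0%N)
    (fun u : 'rV[{mpoly K[n]}]_1 => monomial_ideal U (u 0 0)).
Proof.
move=> U_up; split=> [|u v uU vU|f u uU|d j u uU].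
- by rewrite mxE; apply: monomial_ideal0.
- by rewrite mxE; apply: monomial_idealD.
- by rewrite mxE; apply: monomial_idealM.
move=> m; rewrite mxE mcoeff_msupp mcoeff_gpart; case: ifP => _; last by rewrite eqxx.
by rewrite -mcoeff_msupp; apply: uU.
Qed.

Lemma regularity_sqfree_symbolic_power (K : fieldType) (n : nat) (e : rel 'I_n)
    (M : {set {set 'I_n}}) (s : nat) :
  symmetric e -> irreflexive e -> induced_matching e M ->
  (forall N, matching e N -> #|N| <= #|M|)%N ->
  (0 < s)%N -> (s <= tau e setT)%N ->
  regularity (sqfree_symbolic_power (edge_ideal K e) s) (s + #|M|)%N.
Proof.
move=> e_sym e_irr Mind Mmax s_gt0 sT.
pose U A := (s <= tau e A)%N.
set J := sqfree_symbolic_power _ _.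
have JE f : J f <-> monomial_ideal U f by exact: sqfree_symbolic_powerE.
have U_up (A B : {set 'I_n}) : A \subset B -> U A -> U B by move=> AB /leq_trans; apply; apply: tauS.
have complexE W B : tau_complex e s W set0 B = (B \subset W) && U (W :\: B).
  by rewrite /tau_complex setU0.
have homE i j : koszul_vanishes (q := 1) (fun=> 0%N) (fun u : 'rV_1 => J (u 0 0)) i j <->
    forall X : {set 'I_n}, #|X| = j -> acyclic K (tau_complex e s X set0) i.
  have -> : koszul_vanishes (q := 1) (fun=> 0%N) (fun u : 'rV_1 => J (u 0 0)) i j <->
      koszul_vanishes (q := 1) (fun=> 0%N)
        (fun u : 'rV[{mpoly K[n]}]_1 => monomial_ideal U (u 0 0)) i j.
    by split; apply: eq_koszul_vanishes => u; rewrite JE.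
  rewrite -koszul_vanishes_ideal.
  by split=> h X /h; apply: eq_acyclic => B; rewrite complexE.
have tau0 : tau e set0 = 0%N.
  by apply/eqP; rewrite -leqn0 -(cards0 'I_n); apply: tau_le; apply/coversP => i; rewrite inE.
have bound i j : (s + #|M| + i < j)%N ->
    koszul_vanishes (q := 1) (fun=> 0%N) (fun u : 'rV_1 => J (u 0 0)) i j.
  move=> ij; apply/homE => X Xj; apply: (acyclic_tau e_sym e_irr Mind Mmax).
  - exact: sub0set.
  - by rewrite -setI_eq0 setI0.
  - by rewrite tau0.
  - by rewrite Xj cards0 addn0.
have shiftE F : minimal_graded_free_resolution F J -> forall i j,
    (#|[set k | @gf_shift _ _ F i k == j]| != 0%N) <->
    ~ koszul_vanishes (q := 1) (fun=> 0%N) (fun u : 'rV_1 => J (u 0 0)) i j.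
  move=> minF i j; rewrite (koszul_vanishes_shifts minF) -lt0n; split.
    by move/card_gt0P=> [k]; rewrite inE => kj /(_ k); rewrite kj.
  move=> nall; apply/card_gt0P; case: (pickP (fun k => @gf_shift _ _ F i k == j)) => [k kj|h].
    by exists k; rewrite inE.
  by case: nall => k; rewrite h.
split=> [|i j b [F minF ->] /eqP/(shiftE F minF) nv].
  have [||F minF] := @minimal_resolution_exists n K J.
  - have gU := monomial_ideal_graded K U_up.
    split=> [|u v /JE uJ /JE vJ|f u /JE uJ|d j u /JE uJ]; apply/JE.
    + exact: (gsub0 gU).
    + exact: (gsubD gU uJ vJ).
    + exact: (gsubZ gU f uJ).
    + exact: (gsub_grow gU d j uJ).
  - by move=> i; exists (s + #|M| + i)%N => j; apply: bound.
  (* Here |W| - i = s + |M|, and the nonzero class in multidegree W forces a shift |W| in step i of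
     the resolution. *)
  have [W [i [Wi nW]]] := exists_not_acyclic e_sym e_irr Mind Mmax K s_gt0 sT.
  exists i, #|W|, #|[set k | @gf_shift _ _ F i k == #|W|]|; split.
  - by exists F.
  - by apply/eqP/(shiftE F minF) => /homE/(_ W (erefl _)).
  - by rewrite Wi [Posz (i + _)]PoszD addrAC subrr add0r.
have [ij|ij] := leqP j (s + #|M| + i)%N; last by case: nv; apply: bound.
by rewrite Num.Theory.lerBlDr -PoszD lez_nat.
Qed.

Local Close Scope ring_scope.

Theorem theorem5p5 (K : fieldType) (n : nat) (e : rel 'I_n)
    (e_sym : symmetric e) (e_irr : irreflexive e)
    (e_CW : cameron_walker e)
    (s : nat) (s_ge1 : (1 <= s)%N) (s_le : le_height s (edge_ideal K e)) :
  regularity (sqfree_symbolic_power (edge_ideal K e) s)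
    (Posz (s + ind_match e)).
Proof.
have [M [Mind <- Mmax]] := cameron_walker_matching e_CW.
exact: regularity_sqfree_symbolic_power (le_height_tau s_le).
Qed.
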